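(* Let $C\ge 2$ be an integer and let $T$ be a set of positive integers that contains at most $C$ elements in every interval $(2^j,2^{j+1}]$, $j\in\mathbb{Z}$. Then there exists a real $\theta$ that is $\frac{1}{64C\log_2 C}$-regular for all $t\in T$. Moreover, if $T$ is computable, then such a $\theta$ can be chosen to be a computable real.
   Context: For a real $x$, $d(x,\mathbb{Z})$ denotes the distance from $x$ to the nearest integer. For $\varepsilon>0$ and a positive integer $t$, a real $\theta$ is $\varepsilon$-regular for the denominator $t$ if $d(t\theta,\mathbb{Z})>\varepsilon$. *)

(* Defs.v *)
From HB Require Import structures.
From mathcomp Require Import all_boot all_order all_algebra.
From mathcomp Require Import all_classical all_reals all_analysis.

Set Implicit Arguments.
Unset Strict Implicit.
Unset Printing Implicit Defensive.

Import Order.TTheory GRing.Theory Num.Theory.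

Local Open Scope classical_set_scope.
Local Open Scope ring_scope.

(* Total recursive functions: the least class containing zero, successor and
   projections, closed under composition, primitive recursion and minimization
   of regular functions (those whose least zero exists for every argument).
   Primitive recursion and minimization are given by the equations that
   determine the function [g] being defined. *)
Inductive recursive : forall n : nat, (n.-tuple nat -> nat) -> Prop :=
| recursive_zero n : recursive (fun _ : n.-tuple nat => 0%N)
| recursive_succ : recursive (fun v : 1.-tuple nat => (tnth v ord0).+1)
| recursive_proj n (i : 'I_n) : recursive (fun v : n.-tuple nat => tnth v i)
| recursive_comp m n (f : m.-tuple nat -> nat) (h : 'I_m -> n.-tuple nat -> nat) :
    recursive f -> (forall i, recursive (h i)) ->
    recursive (fun v : n.-tuple nat => f [tuple h i v | i < m])
| recursive_prec n (f : n.-tuple nat -> nat) (h : n.+2.-tuple nat -> nat)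
    (g : n.+1.-tuple nat -> nat) :
    recursive f -> recursive h ->
    (forall v : n.-tuple nat, g [tuple of 0%N :: v] = f v) ->
    (forall k (v : n.-tuple nat),
      g [tuple of k.+1 :: v] = h [tuple of k :: g [tuple of k :: v] :: v]) ->
    recursive g
| recursive_min n (f : n.+1.-tuple nat -> nat) (g : n.-tuple nat -> nat) :
    recursive f ->
    (forall v : n.-tuple nat, f [tuple of g v :: v] = 0%N) ->
    (forall (v : n.-tuple nat) k, (k < g v)%N -> f [tuple of k :: v] <> 0%N) ->
    recursive g.

Definition computable_fun (f : nat -> nat) : Prop :=
  recursive (fun v : 1.-tuple nat => f (tnth v ord0)).

Definition computable_set (T : set nat) : Prop :=
  computable_fun (fun t => nat_of_bool `[< T t >]).

(* [x] is the limit of the computable sequence of rationals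
   (-1) ^ s(k) * a(k) / b(k), with error at most 2 ^ (-k) at step [k]. *)
Definition computable_real (R : realType) (x : R) : Prop :=
  exists s a b : nat -> nat,
    [/\ computable_fun s, computable_fun a, computable_fun b,
        forall k, b k <> 0%N &
        forall k, `|x - (-1) ^+ s k * (a k)%:R / (b k)%:R| <= 2 ^- k].

Definition dist_int (R : realType) (x : R) : R :=
  inf (range (fun n : int => `|x - n%:~R|)).

Definition eps_regular (R : realType) (eps : R) (t : nat) (theta : R) : Prop :=
  eps < dist_int (t%:R * theta).

Definition log2 (R : realType) (x : R) : R := ln x / ln 2.

Definition dyadic_interval (R : realType) (j : int) : set nat :=
  [set t | (2 : R) ^ j < t%:R <= (2 : R) ^ (j + 1)].

(* Main.v *)
(**
Partition T into octaves (2^(i-1), 2^i] and remove from the line, octave after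
octave, the points at distance at most 1/(E t) from (1/t)Z, where 1/E is slightly
larger than the required eps. Write A_K for what is left after K octaves. A bad
set of octave K + h meets a union A of intervals in measure at most
(2/E) (mu(A) + N(A)/t), N(A) being the number of components of A. So, apart from
the next h octaves, the loss is proportional to the measure left plus a
multiple of 2^-K times the number of components, and the latter grows by at most
one for each right end of a bad interval lying in A_K. Hence, with
rho = 1 - 1/m and h = m - 1, the potential
    mu(A_K) - 2 kappa 2^-K N(A_K)
      - sum_(j < h) rho^-(j+1) * (measure and component cost of octave K + j)
loses at most a factor rho < 1 at each step, up to an error O(2^-K).

Counting components by these right ends makes the whole potential additive over
subintervals; a subinterval may have one more component than right ends, which is
where the error comes from. As 2 rho > 1, the potential decays more slowly than
2^-K, so after every second octave the current interval can be
halved and one half keeps a potential at least 2^-K. The nested intervals converge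
to theta. The bad sets being unions of cells of a rational grid, the potential is
a rational number computed from T, which makes theta computable with T.
*)

Require Import Defs.
From HB Require Import structures.
From mathcomp Require Import all_boot all_order all_algebra.
From mathcomp Require Import zify ring lra.
From mathcomp Require Import all_classical all_reals all_analysis.

Set Implicit Arguments.
Unset Strict Implicit.
Unset Printing Implicit Defensive.

Import Order.TTheory GRing.Theory Num.Theory.

Local Open Scope classical_set_scope.
Local Open Scope card_scope.
Local Open Scope ring_scope.

(** * Runs and periodic sets *)

Section PeriodicCounting.
Local Open Scope nat_scope.

Lemma sum_window_modn (p y : nat) (F : nat -> nat) : 0 < p ->
  \sum_(y <= z < y + p) F (z %% p) = \sum_(0 <= r < p) F r.
Proof.
move=> p0; elim: y => [|y IHy].
  by rewrite add0n; apply: eq_big_nat => i /andP[_ ip]; rewrite modn_small.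
rewrite -IHy addSn big_nat_recr /=; last by lia.
by rewrite [RHS]big_ltn ?modnDr 1?addnC //; lia.
Qed.

Lemma sum_window_periodic (p c y : nat) (P : nat -> bool) : 0 < p ->
    (forall z, P (z + p) = P z) -> \sum_(0 <= r < p) P r = c ->
  \sum_(y <= z < y + p) P z = c.
Proof.
move=> p0 Pp <-; rewrite -(sum_window_modn y (fun r => P r) p0).
apply: eq_bigr => z _; rewrite {1}(divn_eq z p) addnC; congr nat_of_bool.
elim: (z %/ p) => [|k IHk]; first by rewrite mul0n addn0.
by rewrite mulSn addnCA addnC Pp.
Qed.

(* A full window of length p ending in X sees p points of X; otherwise it sees
   the start of a run of X. *)
Lemma window_run_start (X : nat -> bool) (st : nat -> nat) (a p z : nat) :
    0 < p -> a <= z -> X z ->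
    (forall y, a <= y <= z -> X y -> (y == a) || ~~ X y.-1 -> 0 < st y) ->
  p <= \sum_(a <= y < z.+1 | z < y + p) (X y + p * st y).
Proof.
move=> p0; elim: p p0 z => // p IHp _ z az Xz st1.
case: (posnP p) => [p00|p0].
  subst p; rewrite big_mkcond big_nat_recr //= addn1 ltnS leqnn Xz; lia.
case: (boolP ((z == a) || ~~ X z.-1)) => [zst|].
  rewrite big_mkcond big_nat_recr //= addnS ltnS leq_addr.
  have := st1 z; rewrite az leqnn => /(_ isT Xz zst); nia.
rewrite negb_or negbK => /andP[za Xz1].
(* Here [z] continues a run, so the window of length [p] ending at [z.-1] takes over and [z] itself
   adds one point. *)
have zP : z.-1.+1 = z by lia.
have az1 : a <= z.-1 by lia.
have le1 : p <= \sum_(a <= y < z | z.-1 < y + p) (X y + p * st y).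
  rewrite -[in X in \sum_(_ <= _ < X | _) _]zP; apply: IHp => // y ?.
  by apply: st1; lia.
rewrite big_mkcond big_nat_recr //= addnS ltnS leq_addr Xz.
suff : p <= \sum_(a <= i < z) (if z < i + p.+1 then X i + p.+1 * st i else 0).
  by lia.
apply: (leq_trans le1); rewrite big_mkcond; apply: leq_sum => i _.
have -> : (z.-1 < i + p) = (z < i + p.+1) by lia.
case: ifP => // _; nia.
Qed.

(** Double counting: by [window_run_start] each [z] in both sets finds weight at least [p] in the
    window of length [p] ending at it, while the weight of [y] is used only by the [z] in
    [[y, y + p)], of which [P] contains [c]. *)
Lemma periodic_run_count (X P : nat -> bool) (st : nat -> nat) (a b p c : nat) :
    0 < p -> (forall z, P (z + p) = P z) -> \sum_(0 <= r < p) P r = c ->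
    (forall y, a <= y < b -> X y -> (y == a) || ~~ X y.-1 -> 0 < st y) ->
  p * \sum_(a <= z < b) X z * P z <=
    c * (\sum_(a <= z < b) X z + p * \sum_(a <= z < b) st z).
Proof.
move=> p0 Pp Pc st1; rewrite !big_distrr /= -big_split /= big_distrr /=.
pose w z y := (y <= z) && (z < y + p) : nat.
apply: (@leq_trans (\sum_(a <= z < b) \sum_(a <= y < b)
                      w z y * P z * (X y + p * st y))).
  rewrite !big_nat; apply: leq_sum => z /andP[az zb].
  case Xz: (X z) => //; case Pz: (P z); rewrite ?muln0 // muln1.
  apply: (@leq_trans (\sum_(a <= y < z.+1 | z < y + p) (X y + p * st y))).
    apply: window_run_start => // y /andP[ay yz]; apply: st1; lia.
  rewrite [leqRHS](big_cat_nat (n := z.+1)) //=; last exact: leq_trans (leqnSn z).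
  apply: leq_trans (leq_addr _ _); rewrite big_mkcond /= !big_nat.
  apply: leq_sum => y /andP[ay yz].
  have -> : w z y = (z < y + p) by rewrite /w -ltnS yz.
  by case: ifP; rewrite ?muln1 ?mul1n.
rewrite exchange_big /= !big_nat; apply: leq_sum => y /andP[ay yb].
rewrite -big_distrl /= leq_mul2r; apply/orP; right.
rewrite -(sum_window_periodic y p0 Pp Pc).
rewrite (big_cat_nat (n := y)) ?(ltnW yb) //= big_nat big1 ?add0n; last first.
  by move=> z /andP[_ zy]; rewrite /w leqNgt zy.
have [le|gt] := leqP b (y + p).
  rewrite [leqRHS](big_cat_nat (n := b)) ?(ltnW yb) //=.
  apply: leq_trans (leq_addr _ _); apply: leq_sum => z _.
  by rewrite /w; case: (_ && _); rewrite ?mul1n.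
rewrite (big_cat_nat (n := y + p)) ?leq_addr ?(ltnW gt) //=.
rewrite [X in _ + X]big_nat [X in _ + X]big1 ?addn0; last first.
  by move=> z /andP[pz _]; rewrite /w [z < _]ltnNge pz andbF.
apply: leq_sum => z _; rewrite /w; case: (_ && _); by rewrite ?mul1n.
Qed.

End PeriodicCounting.

(** * The potential *)

(* [b i z] and [e i z] count the bad sets of octave [i] that contain the cell [z],
   respectively that end just before it, and [D] is the number of cells per unit
   of length. A cell costs its measure for each bad set covering it, and
   [kappa / 2 ^ i] for each new component that octave [i] starts there. *)
Section Potential.
Variables (R : realFieldType) (b e : nat -> nat -> nat).
Variables (D kappa rho : R) (h : nat).
Hypotheses (D_gt0 : 0 < D) (kappa_ge0 : 0 <= kappa) (rho_gt0 : 0 < rho).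

Definition free (K z : nat) : bool := (\sum_(0 <= i < K) b i z == 0)%N.

Definition edges (K z : nat) : nat := (\sum_(0 <= i < K) e i z)%N.

Definition cost (i z : nat) : R :=
  (b i z)%:R + kappa / 2 ^+ i * D * (e i z)%:R.

Definition future_cost (K z : nat) : R :=
  \sum_(0 <= j < h) rho ^- j.+1 * cost (K + j) z.

Definition density (K z : nat) : R :=
  1 - 2 * kappa / 2 ^+ K * D * (edges K z)%:R - future_cost K z.

Definition potential (K l r : nat) : R :=
  \sum_(l <= z < r) (free K z)%:R * density K z.

Lemma cost_ge0 i z : 0 <= cost i z.
Proof.
by rewrite addr_ge0 ?ler0n // !mulr_ge0 ?ler0n // ?(ltW D_gt0) // invr_ge0 exprn_ge0.
Qed.

Lemma density_le1 K z : density K z <= 1.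
Proof.
rewrite /density -addrA gerDl -opprD oppr_le0 addr_ge0 //.
  rewrite !mulr_ge0 ?ler0n // ?(ltW D_gt0) // invr_ge0 exprn_ge0 //.
rewrite sumr_ge0 // => j _; rewrite mulr_ge0 ?cost_ge0 //.
by rewrite invr_ge0 exprn_ge0 // ltW.
Qed.

Lemma future_costS K z :
  future_cost K.+1 z =
    rho * future_cost K z - cost K z + rho ^- h * cost (K + h) z.
Proof.
rewrite /future_cost; elim: h => [|n IHn].
  by rewrite !big_geq // expr0 invr1 addn0; ring.
rewrite !big_nat_recr //= IHn addSn addnS exprSr invfM.
by field; rewrite ?expf_neq0 ?gt_eqF // ?exprn_gt0 ?ltr0n.
Qed.

(** The edges of octave [K] cancel: [cost K] charged them [kappa / 2 ^+ K], which is the rate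
    [2 * kappa / 2 ^+ K.+1] of the next density. The rate of older edges halves instead of being
    multiplied by [rho]; the difference is the term in [2 * rho - 1]. *)
Lemma densityS K z :
  density K.+1 z - (b K z)%:R =
    rho * density K z + (1 - rho)
    + kappa / 2 ^+ K * (2 * rho - 1) * D * (edges K z)%:R
    - rho ^- h * cost (K + h) z.
Proof.
rewrite /density future_costS /cost /edges big_nat_recr //= natrD exprSr.
by field; rewrite ?expf_neq0 ?gt_eqF // ?exprn_gt0 ?ltr0n.
Qed.

(** A free cell hit by octave [K] drops out, and there the left side, equal to
    [density K.+1 z - (b K z)%:R], is nonpositive because a density is at most 1. *)
Lemma potential_step_pointwise K z :
  (free K z)%:R * (rho * density K z + (1 - rho)
    + kappa / 2 ^+ K * (2 * rho - 1) * D * (edges K z)%:R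
    - rho ^- h * cost (K + h) z) <= (free K.+1 z)%:R * density K.+1 z.
Proof.
rewrite -densityS /free big_nat_recr //= addn_eq0.
case: (_ == 0)%N; rewrite /= ?mul0r // mul1r.
case: eqP => [->|/eqP]; first by rewrite mul1r subr0.
rewrite -lt0n => b_gt0; rewrite mul0r subr_le0 (le_trans (density_le1 _ _)) //.
by rewrite ler1n.
Qed.

(** Octave [K + h] enters the look-ahead with weight [rho ^- h], so its charge is at most [1 - rho]
    times the bracket in the last hypothesis. The terms in [M] and [N] are paid by the [1 - rho] per
    free cell and by the edge surplus of [densityS]; the [+ 1] remains as the error. *)
Lemma potential_step (q : R) K l r :
  let M := \sum_(l <= z < r) (free K z)%:R in
  let N := \sum_(l <= z < r) (free K z)%:R * (edges K z)%:R in
  q <= (1 - rho) * rho ^+ h ->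
  (1 - rho) * 2 / 2 ^+ h <= kappa * (2 * rho - 1) ->
  \sum_(l <= z < r) (free K z)%:R * cost (K + h) z <=
    q * (M + 2 * D / 2 ^+ (K + h) * (N + 1)) ->
  rho * potential K l r - (1 - rho) * 2 / 2 ^+ h * D / 2 ^+ K
    <= potential K.+1 l r.
Proof.
move=> M N q_le kappa_le enter.
have M0 : 0 <= M by apply: sumr_ge0.
have N0 : 0 <= N by apply: sumr_ge0 => z _; rewrite mulr_ge0.
have D2 n : 0 < D / 2 ^+ n by rewrite divr_gt0 // exprn_gt0.
have rh0 : 0 < rho ^+ h by rewrite exprn_gt0.
apply: le_trans (ler_sum _ (fun z _ => potential_step_pointwise K z)).
have -> : \sum_(l <= z < r) (free K z)%:R * (rho * density K z + (1 - rho)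
    + kappa / 2 ^+ K * (2 * rho - 1) * D * (edges K z)%:R
    - rho ^- h * cost (K + h) z) =
  rho * potential K l r + (1 - rho) * M
    + kappa / 2 ^+ K * (2 * rho - 1) * D * N
    - rho ^- h * \sum_(l <= z < r) (free K z)%:R * cost (K + h) z.
  rewrite /potential /M /N !mulr_sumr -sumrN -!big_split /=.
  by apply: eq_bigr => z _; ring.
set X := \sum_(_ <= _ < _) _ * cost _ _ in enter *.
set W := M + 2 * D / 2 ^+ (K + h) * (N + 1) in enter.
have W0 : 0 <= W.
  rewrite addr_ge0 // mulr_ge0 ?addr_ge0 //.
  by rewrite -mulrA mulr_ge0 // ltW.
have X_le : rho ^- h * X <= (1 - rho) * W.
  rewrite mulrC ler_pdivrMr // (le_trans enter) //.
  by rewrite mulrAC; apply: ler_wpM2r.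
have WE : W = M + (2 / 2 ^+ h) * (D / 2 ^+ K) * (N + 1).
  by rewrite /W exprD; field; rewrite !expf_neq0.
have := ler_wpM2r (mulr_ge0 (ltW (D2 K)) N0) kappa_le.
move: X_le; rewrite {}WE.
set d := D / 2 ^+ K; set u := 2 / 2 ^+ h.
have -> : (1 - rho) * 2 / 2 ^+ h * D / 2 ^+ K = (1 - rho) * u * d.
  by rewrite /u /d; ring.
have -> : kappa / 2 ^+ K * (2 * rho - 1) * D * N =
  kappa * (2 * rho - 1) * (d * N) by rewrite /d; ring.
have -> : (1 - rho) * 2 / 2 ^+ h = (1 - rho) * u by rewrite /u; ring.
move=> H1 H2.
have -> : rho * potential K l r - (1 - rho) * u * d =
  rho * potential K l r + (1 - rho) * M + (1 - rho) * u * (d * N)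
   - (1 - rho) * (M + u * d * (N + 1)) by ring.
lra.
Qed.

Lemma potential_cat K l m r : (l <= m <= r)%N ->
  potential K l r = potential K l m + potential K m r.
Proof. by case/andP=> lm mr; rewrite /potential (big_cat_nat (n := m)). Qed.

Lemma potential_gt0 K l r : 0 < potential K l r ->
  exists2 z, (l <= z < r)%N & free K z.
Proof.
move=> U0; apply: contrapT => nfree; move: U0; rewrite /potential.
rewrite big_nat big1 ?ltxx // => z zlr; case fz: (free K z); last by rewrite mul0r.
by exfalso; apply: nfree; exists z.
Qed.

(* With no octave processed yet, the geometric weights sum to at most
   [(rho ^- h - 1) / (1 - rho)]. *)
Lemma potential0_ge (q L : R) r :
  q <= (1 - rho) * rho ^+ h -> 0 <= L -> L = r%:R ->
  (forall i, (i < h)%N -> \sum_(0 <= z < r) cost i z <= q * L) ->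
  rho ^+ h * L <= potential 0 0 r.
Proof.
move=> q_le L0 LE costL; rewrite /potential.
have -> : \sum_(0 <= z < r) (free 0 z)%:R * density 0 z =
    L - \sum_(0 <= j < h) rho ^- j.+1 * \sum_(0 <= z < r) cost j z.
  under [in RHS]eq_bigr do rewrite mulr_sumr.
  rewrite exchange_big /= LE -sumrN -[r in r%:R]subn0 -sumr_const_nat -big_split /=.
  apply: eq_bigr => z _; rewrite /free big_geq // mul1r /density /edges big_geq //.
  by rewrite mulr0 subr0.
have gsum n : (1 - rho) * \sum_(0 <= j < n) rho ^- j.+1 = rho ^- n - 1.
  elim: n => [|n IHn]; first by rewrite big_geq // expr0 invr1; ring.
  rewrite big_nat_recr //= mulrDr IHn exprSr.
  by field; rewrite ?expf_neq0 ?gt_eqF // ?exprn_gt0 ?ltr0n.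
have rh0 : 0 < rho ^+ h by rewrite exprn_gt0.
suff : \sum_(0 <= j < h) rho ^- j.+1 * \sum_(0 <= z < r) cost j z <=
    (1 - rho ^+ h) * L by lra.
have -> : (1 - rho ^+ h) * L =
    \sum_(0 <= j < h) rho ^- j.+1 * ((1 - rho) * rho ^+ h * L).
  rewrite -mulr_suml mulrCA mulrA.
  have -> : (1 - rho) * rho ^+ h * \sum_(0 <= j < h) rho ^- j.+1 =
    rho ^+ h * ((1 - rho) * \sum_(0 <= j < h) rho ^- j.+1) by ring.
  by rewrite gsum mulrBr divff ?gt_eqF // mulr1.
rewrite !big_nat; apply: ler_sum => j /= jh.
rewrite ler_wpM2l ?invr_ge0 ?exprn_ge0 ?(ltW rho_gt0) //.
by rewrite (le_trans (costL j jh)) // ler_wpM2r.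
Qed.

End Potential.

(** * Bad cells of a grid *)

Section Grid.
Local Open Scope nat_scope.

(* The unit interval is cut into [E * G] cells. When [t] divides [G], the set of
   points at distance at most [1 / E] from a multiple of [1 / t] is a union of
   cells; [bad] selects these cells and [edge] the cell to the right of each of
   its components. *)
Definition bad (E G t z : nat) : bool := (t * z + G) %% (E * G) < 2 * G.

Definition edge (E G t z : nat) : bool := (t * z + G) %% (E * G) == 2 * G.

(** Doubling [t] expresses [2 ^ (i - 1) < t] within the naturals, also for [i = 0], where only
    [t = 1] qualifies. *)
Definition octave (T : nat -> bool) (i t : nat) : bool :=
  T t && (t <= 2 ^ i < 2 * t).

Lemma octave_gt0 (T : nat -> bool) i t : octave T i t -> 0 < t.
Proof. by rewrite /octave => /and3P[_ _]; lia. Qed.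

Definition bads (T : nat -> bool) (E G i z : nat) : nat :=
  \sum_(0 <= t < (2 ^ i).+1) octave T i t * bad E G t z.

Definition edgs (T : nat -> bool) (E G i z : nat) : nat :=
  \sum_(0 <= t < (2 ^ i).+1) octave T i t * edge E G t z.

Lemma sum_shifted_residues (p e : nat) (F : nat -> nat) : 0 < p ->
  \sum_(0 <= r < p) F ((r + e) %% p) = \sum_(0 <= r < p) F r.
Proof.
move=> p0; rewrite -(sum_window_modn e F p0) -{2}[e]add0n big_addn.
by rewrite addKn.
Qed.

Lemma sum_periods (p c n : nat) (P : nat -> bool) : 0 < p ->
    (forall z, P (z + p) = P z) -> \sum_(0 <= r < p) P r = c ->
  \sum_(0 <= z < n * p) P z = n * c.
Proof.
move=> p0 Pp Pc; elim: n => [|n IHn]; first by rewrite big_geq.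
rewrite !mulSn [p + _]addnC (big_cat_nat (n := n * p)) ?leq_addr //= IHn.
by rewrite (sum_window_periodic _ p0 Pp Pc) addnC.
Qed.

Section OneDenominator.
Variables (E G t : nat).
Hypotheses (E_gt2 : 2 < E) (G_gt0 : 0 < G) (t_gt0 : 0 < t) (tG : t %| G).
(** In cells, [e] is the half-width [1 / (E t)] of a bad interval and [p] the period [1 / t]. *)
Let e := G %/ t.
Let p := E * e.

Let e_gt0 : 0 < e.
Proof. by rewrite divn_gt0 // dvdn_leq. Qed.

Let p_gt0 : 0 < p.
Proof. by rewrite muln_gt0 e_gt0 andbT; lia. Qed.

Let GE : G = t * e.
Proof. by rewrite mulnC divnK. Qed.

Lemma scaled_cell_mod z : (t * z + G) %% (E * G) = t * ((z + e) %% p).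
Proof. by rewrite muln_modr /p mulnCA -GE mulnDr -GE. Qed.

Lemma badE z : bad E G t z = ((z + e) %% p < 2 * e).
Proof.
by rewrite /bad scaled_cell_mod {1}GE mulnCA ltn_pmul2l.
Qed.

Lemma edgeE z : edge E G t z = ((z + e) %% p == 2 * e).
Proof. by rewrite /edge scaled_cell_mod {1}GE mulnCA eqn_pmul2l. Qed.

Lemma bad_periodic z : bad E G t (z + p) = bad E G t z.
Proof. by rewrite !badE addnAC modnDr. Qed.

Lemma edge_periodic z : edge E G t (z + p) = edge E G t z.
Proof. by rewrite !edgeE addnAC modnDr. Qed.

Lemma sum_bad : \sum_(0 <= z < p) bad E G t z = 2 * e.
Proof.
under eq_bigr do rewrite badE.
rewrite (sum_shifted_residues e (fun r => r < 2 * e)) //.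
have ep : 2 * e <= p by rewrite leq_mul2r; lia.
rewrite (big_cat_nat (n := 2 * e)) //= big_nat (eq_bigr (fun=> 1)); last first.
  by move=> i /andP[_ ->].
rewrite -big_nat sum_nat_const_nat big_nat big1 ?addn0 ?subn0 ?muln1 //.
by move=> i /andP[ei _]; rewrite ltnNge ei.
Qed.

Lemma sum_edge : \sum_(0 <= z < p) edge E G t z = 1.
Proof.
under eq_bigr do rewrite edgeE.
rewrite (sum_shifted_residues e (fun r => r == 2 * e)) //.
have ep : 2 * e < p by rewrite ltn_mul2r e_gt0.
rewrite (bigD1_seq (2 * e)) ?mem_index_iota ?ep ?iota_uniq //= eqxx.
by rewrite big1 ?addn0 // => i /negbTE->.
Qed.

Lemma edge_of_exit z : 0 < z -> bad E G t z.-1 -> ~~ bad E G t z -> edge E G t z.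
Proof.
case: z => // z _ /=; rewrite !badE edgeE -leqNgt => h1.
have ep : 2 * e < p by rewrite ltn_mul2r e_gt0.
have -> : (z.+1 + e) %% p = (z + e) %% p + 1.
  by rewrite addSn -addn1 -modnDml modn_small //; lia.
lia.
Qed.

(** On the finer grid the residue is [f] times the old one plus [s < f], so comparing it with
    [2 * (f * e)] ignores [s]. *)
Lemma bad_refine f y s : s < f -> bad E (f * G) t (f * y + s) = bad E G t y.
Proof.
move=> sf; rewrite badE /bad.
have f0 : 0 < f by lia.
have -> : t * (f * y + s) + f * G = t * (f * (y + e) + s).
  by rewrite GE; ring.
have -> : E * (f * G) = t * (f * p) by rewrite /p {1}GE; ring.
rewrite -muln_modr mulnCA {1}GE mulnCA [f * (t * e)]mulnCA mulnCA ltn_pmul2l //.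
have -> : (f * (y + e) + s) %% (f * p) = f * ((y + e) %% p) + s.
  rewrite {1}(divn_eq (y + e) p) mulnDr mulnCA -addnA modnMDl modn_small //.
  by have := ltn_pmod (y + e) p_gt0; nia.
by apply/idP/idP; nia.
Qed.

Lemma edge_refine f y s : s < f ->
  edge E (f * G) t (f * y + s) = (s == 0) && edge E G t y.
Proof.
move=> sf; rewrite edgeE /edge.
have f0 : 0 < f by lia.
have -> : t * (f * y + s) + f * G = t * (f * (y + e) + s).
  by rewrite GE; ring.
have -> : E * (f * G) = t * (f * p) by rewrite /p {1}GE; ring.
rewrite -muln_modr mulnCA {1}GE mulnCA [f * (t * e)]mulnCA mulnCA eqn_pmul2l //.
have -> : (f * (y + e) + s) %% (f * p) = f * ((y + e) %% p) + s.
  rewrite {1}(divn_eq (y + e) p) mulnDr mulnCA -addnA modnMDl modn_small //.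
  by have := ltn_pmod (y + e) p_gt0; nia.
have [lt|gt|->] := ltngtP ((y + e) %% p) (2 * e); rewrite ?andbF ?andbT.
- by apply/negbTE; nia.
- by apply/negbTE; nia.
- by apply/idP/idP; nia.
Qed.

End OneDenominator.

(** Since [G > 0], each truncated difference can reach [G] only on its own side of the multiple. If
    neither does, [t * z + G] exceeds [n * (E * G)] by less than [2 * G], and the cell is bad. *)
Lemma not_bad_far E G t z n : 2 < E -> 0 < G -> ~~ bad E G t z ->
  G <= t * z - n * (E * G) \/ G <= n * (E * G) - t * z.
Proof.
rewrite /bad -leqNgt => E_gt2 G_gt0 far.
have [|h1] := leqP G (t * z - n * (E * G)); first by left.
have [|h2] := leqP G (n * (E * G) - t * z); first by right.
have zE : t * z + G = n * (E * G) + (t * z + G - n * (E * G)) by lia.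
by move: far; rewrite zE modnMDl modn_small; nia.
Qed.

End Grid.

Lemma free_not_bad (T : nat -> bool) E G K i t z : (i < K)%N -> octave T i t ->
  free (bads T E G) K z -> ~~ bad E G t z.
Proof.
move=> iK oct; rewrite /free sum_nat_seq_eq0 => /allP /(_ i).
rewrite mem_index_iota iK /= /bads => /(_ isT).
rewrite sum_nat_seq_eq0 => /allP /(_ t).
rewrite mem_index_iota oct mul1n eqb0; apply.
by case/and3P: oct; rewrite ltnS.
Qed.

(** * The cost of one octave on the grid *)

Section GridPotential.
Variables (R : realFieldType) (T : nat -> bool) (C E G : nat) (kappa rho : R).
Variable h : nat.
Hypotheses (E_gt2 : (2 < E)%N) (G_gt0 : (0 < G)%N) (kappa_ge0 : 0 <= kappa).
Hypothesis T_sparse :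
  forall i, (\sum_(0 <= t < (2 ^ i).+1) octave T i t <= C)%N.
Hypothesis rho_gt0 : 0 < rho.

Let D : R := (E * G)%:R.
Let b := bads T E G.
Let e := edgs T E G.

Let D_gt0 : 0 < D.
Proof. by rewrite ltr0n muln_gt0 G_gt0 andbT; lia. Qed.

Lemma cost_octave i z :
  cost b e D kappa i z =
    \sum_(0 <= t < (2 ^ i).+1 | octave T i t)
      ((bad E G t z)%:R + kappa / 2 ^+ i * D * (edge E G t z)%:R).
Proof.
rewrite /cost /b /e /bads /edgs !natr_sum mulr_sumr -big_split /= [RHS]big_mkcond.
apply: eq_bigr => t _; case: (octave T i t); first by rewrite !mul1n.
by rewrite !mul0n mulr0 addr0.
Qed.

Lemma sum_octave_le i (F : nat -> R) (B : R) : 0 <= B ->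
  (forall t, octave T i t -> F t <= B) ->
  \sum_(0 <= t < (2 ^ i).+1 | octave T i t) F t <= C%:R * B.
Proof.
move=> B0 FB; apply: (@le_trans _ _ (\sum_(0 <= t < (2 ^ i).+1 | octave T i t) B)).
  exact: ler_sum.
have -> : \sum_(0 <= t < (2 ^ i).+1 | octave T i t) B =
    (\sum_(0 <= t < (2 ^ i).+1) octave T i t)%:R * B.
  rewrite natr_sum mulr_suml big_mkcond; apply: eq_bigr => t _.
  by case: (octave T i t); rewrite ?mul1r ?mul0r.
by rewrite ler_wpM2r // ler_nat.
Qed.

(** A component of the free set can start only where a bad interval ends, which is why counting
    edges bounds the number of components. *)
Lemma free_start K y :
    (forall i t, (i < K)%N -> octave T i t -> (t %| G)%N) ->
  free b K y -> ~~ free b K y.-1 -> (0 < edges e K y)%N.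
Proof.
(* At [y = 0] the predecessor is [y] itself, so the two hypotheses on [y] contradict each other. *)
move=> divG fy nfy; have y0 : (0 < y)%N.
  by case: y fy nfy => //= ->.
move: nfy; rewrite /free sum_nat_seq_neq0 => /hasP[i].
rewrite mem_index_iota /= => iK; rewrite /b /bads sum_nat_seq_neq0 => /hasP[t].
rewrite mem_index_iota /= => tb; rewrite muln_eq0 negb_or !eqb0 !negbK.
case/andP=> oct bd.
have nbd := free_not_bad iK oct fy.
have ed := edge_of_exit E_gt2 G_gt0 (octave_gt0 oct) (divG _ _ iK oct) y0 bd nbd.
rewrite lt0n /edges sum_nat_seq_neq0; apply/hasP; exists i.
  by rewrite mem_index_iota.
rewrite /= /e /edgs sum_nat_seq_neq0; apply/hasP; exists t.
  by rewrite mem_index_iota.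
by rewrite /= oct ed.
Qed.

(** For each of the at most [C] denominators, [periodic_run_count] is applied to the bad cells,
    [2 * e] per period, and to the edges, one per period; this gives the terms [2 / E] and [kappa].
    The period is at most [2 * D / 2 ^+ i] cells because [2 ^ i < 2 * t]. *)
Lemma octave_enter K i l r :
    (forall j t, (j <= maxn K i)%N -> octave T j t -> (t %| G)%N) ->
  \sum_(l <= z < r) (free b K z)%:R * cost b e D kappa i z <=
    C%:R * (2 / E%:R + kappa) * (\sum_(l <= z < r) (free b K z)%:R +
      2 * D / 2 ^+ i *
        (\sum_(l <= z < r) (free b K z)%:R * (edges e K z)%:R + 1)).
Proof.
move=> divG; set M := \sum_(l <= z < r) (free b K z)%:R.
set N := \sum_(l <= z < r) (free b K z)%:R * (edges e K z)%:R.
have M0 : 0 <= M by apply: sumr_ge0.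
have N0 : 0 <= N by apply: sumr_ge0 => z _; rewrite mulr_ge0.
have E0 : 0 < E%:R :> R by rewrite ltr0n; lia.
have i2 : 0 < 2 ^+ i :> R by rewrite exprn_gt0.
have Di : 0 < D / 2 ^+ i by rewrite divr_gt0.
have W0 : 0 <= M + 2 * D / 2 ^+ i * (N + 1).
  by rewrite addr_ge0 // mulr_ge0 ?addr_ge0 // -mulrA mulr_ge0 // ltW.
under eq_bigr do rewrite cost_octave mulr_sumr.
rewrite exchange_big /= -[leRHS]mulrA; apply: sum_octave_le.
  by rewrite mulr_ge0 // addr_ge0 // divr_ge0 // ltW.
move=> t oct; have t0 := octave_gt0 oct.
have tG : (t %| G)%N by apply: divG oct; rewrite leq_maxr.
(* A run of free cells in [[l, r)] starts at an edge or is cut off by [l]; the latter is the source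
   of the [+ 1]. *)
pose st z := ((z == l) + free b K z * edges e K z)%N.
have st1 y : (l <= y < r)%N -> free b K y -> (y == l) || ~~ free b K y.-1 ->
    (0 < st y)%N.
  move=> _ fy /orP[/eqP->|nf]; first by rewrite /st eqxx.
  rewrite /st fy mul1n addn_gt0 free_start ?orbT // => j u jK.
  by apply: divG; rewrite leq_max ltnW.
have p_gt0 : (0 < E * (G %/ t))%N.
  by rewrite muln_gt0 (ltn_trans _ E_gt2) //= divn_gt0 // dvdn_leq.
have hb := periodic_run_count p_gt0 (bad_periodic E t0 tG)
  (sum_bad E_gt2 G_gt0 t0 tG) st1.
have he := periodic_run_count p_gt0 (edge_periodic E t0 tG)
  (sum_edge E_gt2 G_gt0 t0 tG) st1.
set A := (\sum_(l <= z < r) free b K z * bad E G t z)%N in hb.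
set B := (\sum_(l <= z < r) free b K z * edge E G t z)%N in he.
set M' := (\sum_(l <= z < r) free b K z)%N in hb he.
set S := (\sum_(l <= z < r) st z)%N in hb he.
have ME : M = M'%:R by rewrite natr_sum.
have S_le : S%:R <= N + 1.
  rewrite natr_sum; under eq_bigr do rewrite natrD natrM.
  rewrite big_split /= addrC lerD2l -natr_sum lern1.
  have [rl|lr] := leqP r l; first by rewrite big_geq.
  rewrite big_ltn // eqxx big_nat big1 // => z /andP[lz _].
  by rewrite gtn_eqF.
have -> : \sum_(l <= z < r) (free b K z)%:R *
    ((bad E G t z)%:R + kappa / 2 ^+ i * D * (edge E G t z)%:R) =
    A%:R + kappa / 2 ^+ i * D * B%:R.
  rewrite /A /B !natr_sum mulr_sumr -big_split /=; apply: eq_bigr => z _.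
  by rewrite !natrM; ring.
have g0 : 0 < (G %/ t)%:R :> R by rewrite ltr0n divn_gt0 // dvdn_leq.
have DE : D = E%:R * (t%:R * (G %/ t)%:R).
  by rewrite -!natrM [(t * _)%N]mulnC divnK.
move: hb he; rewrite -!(ler_nat R) !(natrM, natrD) -ME mul1r.
move: DE g0 S_le; set g := (G %/ t)%:R => DE g0 S_le hb he.
have t2 : t%:R <= 2 ^+ i :> R.
  by rewrite -natrX ler_nat; case/and3P: oct.
have t2' : 2 ^+ i <= 2 * t%:R :> R.
  by rewrite -natrX -natrM ler_nat; case/and3P: oct => _ _ /ltnW.
have t0' : 0 < t%:R :> R by rewrite ltr0n.
have S0 : 0 <= S%:R :> R by [].
have Eg : E%:R * g <= 2 * D / 2 ^+ i.
  rewrite ler_pdivlMr // DE.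
  have -> : 2 * (E%:R * (t%:R * g)) = E%:R * g * (2 * t%:R) by ring.
  by rewrite ler_wpM2l // mulr_ge0 // ltW.
have MS : M + E%:R * g * S%:R <= M + 2 * D / 2 ^+ i * (N + 1).
  by rewrite lerD2l ler_pM // mulr_ge0 // ltW.
rewrite [leRHS]mulrDl; apply: lerD.
  have : A%:R <= 2 / E%:R * (M + E%:R * g * S%:R).
    rewrite mulrAC ler_pdivlMr // -(ler_pM2r g0).
    have -> : A%:R * E%:R * g = E%:R * g * A%:R by ring.
    by apply: (le_trans hb); rewrite le_eqVlt; apply/orP; left; apply/eqP; ring.
  by move/le_trans; apply; rewrite ler_wpM2l // divr_ge0 // ltW.
have -> : kappa / 2 ^+ i * D * B%:R = kappa * (D / 2 ^+ i * B%:R) by ring.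
rewrite ler_wpM2l // (le_trans _ MS) //.
have -> : D / 2 ^+ i * B%:R = t%:R / 2 ^+ i * (E%:R * g * B%:R).
  by rewrite DE; ring.
apply: (@le_trans _ _ (1 * (E%:R * g * B%:R))); last by rewrite mul1r.
by rewrite ler_wpM2r // ?ler_pdivrMr ?mul1r // !mulr_ge0 // ltW.
Qed.

(** The starting interval has length 4, that is [4 * t] whole periods for every [t], so the counts
    are exact and no boundary term appears. The length 4 compensates for a factor [rho ^+ h] that is
    only known to be at least [1 / 4]. *)
Lemma initial_potential :
    (forall i t, (i < h)%N -> octave T i t -> (t %| G)%N) ->
    C%:R * (2 / E%:R + kappa) <= (1 - rho) * rho ^+ h ->
  rho ^+ h * (4 * D) <= potential b e D kappa rho h 0 0 (4 * E * G).
Proof.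
move=> divG q_le; apply: potential0_ge q_le _ _ _ => //.
- by rewrite mulr_ge0 // ltW.
- by rewrite /D -natrM mulnA.
move=> i ih; under eq_bigr do rewrite cost_octave.
have E0 : 0 < E%:R :> R by rewrite ltr0n; lia.
have i2 : 0 < 2 ^+ i :> R by rewrite exprn_gt0.
rewrite exchange_big /= -[leRHS]mulrA; apply: sum_octave_le.
  by rewrite !mulr_ge0 // ?addr_ge0 ?divr_ge0 // ltW.
move=> t oct; have t0 := octave_gt0 oct; have tG := divG _ _ ih oct.
have p_gt0 : (0 < E * (G %/ t))%N.
  by rewrite muln_gt0 (ltn_trans _ E_gt2) //= divn_gt0 // dvdn_leq.
have len : (4 * E * G = 4 * t * (E * (G %/ t)))%N.
  by rewrite -[in LHS](divnK tG); ring.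
have hb := sum_periods (4 * t) p_gt0 (bad_periodic E t0 tG)
  (sum_bad E_gt2 G_gt0 t0 tG).
have he := sum_periods (4 * t) p_gt0 (edge_periodic E t0 tG)
  (sum_edge E_gt2 G_gt0 t0 tG).
rewrite big_split /= -mulr_sumr -!natr_sum len hb he.
have t2 : t%:R <= 2 ^+ i :> R.
  by rewrite -natrX ler_nat; case/and3P: oct.
have -> : (4 * t * (2 * (G %/ t)))%:R = 8 * G%:R :> R.
  by rewrite -natrM -[in RHS](divnK tG); congr _%:R; ring.
rewrite [leRHS]mulrDl; apply: lerD.
  by rewrite /D natrM le_eqVlt; apply/orP; left; apply/eqP; field; rewrite gt_eqF.
have -> : kappa / 2 ^+ i * D * (4 * t * 1)%:R = kappa * (4 * D) * (t%:R / 2 ^+ i).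
  by rewrite muln1 natrM; ring.
by rewrite ler_piMr ?ler_pdivrMr ?mul1r // !mulr_ge0 // ltW.
Qed.

End GridPotential.

(** * Refining the grid *)

Lemma sum_refine (V : nmodType) (f l r : nat) (F : nat -> V) :
  \sum_(f * l <= z < f * r) F z =
    \sum_(l <= y < r) \sum_(0 <= s < f) F (f * y + s)%N.
Proof.
have [rl|lr] := leqP r l.
  by rewrite !big_geq // leq_mul2l rl orbT.
rewrite -(subnKC (ltnW lr)); elim: (r - l)%N => [|n IHn].
  by rewrite addn0 !big_geq.
rewrite addnS big_nat_recr ?leq_addr //= -IHn mulnS addnC.
rewrite (big_cat_nat (n := (f * (l + n))%N)) ?leq_addr ?leq_mul2l ?leq_addr ?orbT //=.
congr (_ + _); rewrite -{1}[(f * (l + n))%N]add0n big_addn addKn.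
by apply: eq_bigr => s _; rewrite addnC.
Qed.

Lemma potential_refine (R : realFieldType) (b e b' e' : nat -> nat -> nat)
    (D kappa rho : R) (h f K l r : nat) : (0 < f)%N ->
    (forall i y s, (i < K + h)%N -> (s < f)%N -> b' i (f * y + s)%N = b i y) ->
    (forall i y s, (i < K + h)%N -> (s < f)%N ->
       e' i (f * y + s)%N = ((s == 0%N) * e i y)%N) ->
  potential b' e' (f%:R * D) kappa rho h K (f * l) (f * r) =
    f%:R * potential b e D kappa rho h K l r.
Proof.
move=> f0 bE eE; rewrite /potential sum_refine mulr_sumr; apply: eq_bigr => y _.
(* [A] is the measure part, the same on all [f] subcells; [B] is the edge part, carried by the first
   subcell alone but [f] times larger through [D]. Both thus scale by [f]. *)
pose A := 1 - \sum_(0 <= j < h) rho ^- j.+1 * (b (K + j) y)%:R.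
pose B := 2 * kappa / 2 ^+ K * D * (edges e K y)%:R +
  \sum_(0 <= j < h) rho ^- j.+1 * (kappa / 2 ^+ (K + j) * D * (e (K + j) y)%:R).
have dens : density b e D kappa rho h K y = A - B.
  rewrite /density /A /B /future_cost /cost.
  under eq_bigr do rewrite mulrDr.
  by rewrite big_split /=; ring.
have dens' s : (s < f)%N ->
    density b' e' (f%:R * D) kappa rho h K (f * y + s) =
      A - (s == 0%N)%:R * (f%:R * B).
  move=> sf; rewrite /density /A /B /future_cost /cost /edges.
  have -> : (\sum_(0 <= i < K) e' i (f * y + s))%N =
      ((s == 0) * \sum_(0 <= i < K) e i y)%N.
    rewrite big_distrr /= !big_nat; apply: eq_bigr => i /andP[_ iK].
    by rewrite eE // ltn_addr.
  have -> : \sum_(0 <= j < h) rho ^- j.+1 * ((b' (K + j) (f * y + s))%:R +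
      kappa / 2 ^+ (K + j) * (f%:R * D) * (e' (K + j) (f * y + s))%:R) =
    \sum_(0 <= j < h) rho ^- j.+1 * (b (K + j) y)%:R + (s == 0%N)%:R *
      (f%:R * \sum_(0 <= j < h) rho ^- j.+1 *
          (kappa / 2 ^+ (K + j) * D * (e (K + j) y)%:R)).
    rewrite !mulr_sumr -big_split /= !big_nat; apply: eq_bigr => j /andP[_ jh].
    by rewrite bE ?eE ?ltn_add2l // natrM; ring.
  by rewrite natrM; ring.
have fr s : (s < f)%N -> free b' K (f * y + s) = free b K y.
  move=> sf; rewrite /free; congr (_ == _)%N; rewrite !big_nat.
  by apply: eq_bigr => i /andP[_ iK]; rewrite bE // ltn_addr.
rewrite dens big_nat (eq_bigr (fun s => (free b K y)%:R *
   (A - (s == 0%N)%:R * (f%:R * B)))); last first.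
  by move=> s /andP[_ sf]; rewrite fr // dens'.
rewrite -big_nat -mulr_sumr big_split /= sumr_const_nat subn0 sumrN -mulr_suml.
have -> : \sum_(0 <= s < f) (s == 0%N)%:R = 1 :> R.
  rewrite big_ltn // eqxx big_nat big1 ?addr0 // => s /andP[s0 _].
  by rewrite gtn_eqF.
by rewrite -mulr_natl; ring.
Qed.

(** * Halving *)

Section IntegerPotential.
Variables (b e : nat -> nat -> nat) (D n k h : nat).

(** A common denominator for the densities at [rho = n / n.+1] and [kappa = 1 / k]. Clearing it, and
    moving negative terms across in [solvent], turns the bound on the potential into a test on
    naturals that a recursive function can perform. *)
Definition gain (K : nat) : nat := (k * 2 ^ (K + h) * n ^ h)%N.

Definition debt (K z : nat) : nat :=
  (D * 2 ^ h.+1 * n ^ h * edges e K z +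
   \sum_(0 <= j < h) n.+1 ^ j.+1 * n ^ (h - j.+1) *
     (k * 2 ^ (K + h) * b (K + j) z + D * 2 ^ (h - j) * e (K + j) z))%N.

Definition solvent (K l r : nat) : bool :=
  (\sum_(l <= z < r) free b K z * debt K z + D * (k * 2 ^ h * n ^ h) <=
   \sum_(l <= z < r) free b K z * gain K)%N.

Lemma gain_density (R : realFieldType) K z : (0 < n)%N -> (0 < k)%N ->
  (gain K)%:R * density b e D%:R k%:R^-1 (n%:R / n.+1%:R) h K z =
    (gain K)%:R - (debt K z)%:R :> R.
Proof.
move=> n0 k0; rewrite /density /debt natrD natr_sum !mulrBr mulr1 opprD addrA.
have nn : n%:R != 0 :> R by rewrite pnatr_eq0 -lt0n.
have kn : k%:R != 0 :> R by rewrite pnatr_eq0 -lt0n.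
have n1n : n.+1%:R != 0 :> R by rewrite pnatr_eq0.
congr (_ - _ - _).
  rewrite /gain !natrM !natrX !exprD exprS.
  by field; rewrite kn /= expf_neq0.
rewrite /future_cost mulr_sumr !big_nat; apply: eq_bigr => j /andP[_ jh].
rewrite /cost /gain !natrM natrD !natrM !natrX.
have -> : 2 ^+ (h - j) = 2 ^+ h / 2 ^+ j :> R.
  by rewrite -expfB_cond // pnatr_eq0 /= ltnW.
have -> : n%:R ^+ (h - j.+1) = n%:R ^+ h / n%:R ^+ j.+1 :> R.
  by rewrite -expfB_cond // (negbTE nn).
rewrite expr_div_n invf_div !exprD.
by field; rewrite kn !expf_neq0.
Qed.

Lemma solventE (R : realFieldType) K l r : (0 < n)%N -> (0 < k)%N ->
  solvent K l r =
    (D%:R / 2 ^+ K <=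
      potential b e D%:R k%:R^-1 (n%:R / n.+1%:R) h K l r :> R).
Proof.
move=> n0 k0.
have g0 : 0 < (gain K)%:R :> R by rewrite ltr0n !muln_gt0 !expn_gt0 k0 n0.
rewrite -(ler_pM2l g0) /potential mulr_sumr.
have -> : \sum_(l <= z < r) (gain K)%:R * ((free b K z)%:R *
    density b e D%:R k%:R^-1 (n%:R / n.+1%:R) h K z) =
    (\sum_(l <= z < r) free b K z * gain K)%:R -
    (\sum_(l <= z < r) free b K z * debt K z)%:R :> R.
  rewrite !natr_sum -sumrB; apply: eq_bigr => z _.
  by rewrite mulrCA gain_density // !natrM mulrBr.
have -> : (gain K)%:R * (D%:R / 2 ^+ K) = (D * (k * 2 ^ h * n ^ h))%:R :> R.
  rewrite /gain !natrM !natrX exprD; field.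
  by rewrite expf_neq0.
by rewrite lerBrDl -natrD ler_nat.
Qed.

End IntegerPotential.

(** At least [7/8 - 1/8 = 3/4] of [x] is left after one step and [21/32 - 1/16 = 19/32] after
    two. *)
Lemma two_decay_steps (R : realFieldType) (rho x u0 u1 u2 : R) :
    7 / 8 <= rho -> 0 <= x -> x <= u0 -> rho * u0 - 1 / 8 * x <= u1 ->
  rho * u1 - 1 / 8 * (x / 2) <= u2 -> x / 2 <= u2.
Proof.
move=> rho7 x0 u0x s1 s2.
have r0 : (0 : R) <= 7 / 8 by lra.
have h1 : 7 / 8 * x <= rho * u0 by apply: ler_pM.
have h2 : 7 / 8 * (3 / 4 * x) <= rho * u1 by apply: ler_pM => //; lra.
lra.
Qed.

(** * Choice of the nested intervals *)

Section NestedIntervals.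
Variables (T : nat -> bool) (E n k h : nat).

(* Stage [d] works on intervals [4 q / 2 ^ d, 4 (q + 1) / 2 ^ d], cut into
   [width d] cells of length [1 / (E * grid d)], after [2 d] octaves. *)
Definition grid (d : nat) : nat := (2 ^ d * (2 ^ (2 * d + h))`!)%N.

Definition width (d : nat) : nat := (4 * E * (2 ^ (2 * d + h))`!)%N.

Definition alive (d q : nat) : bool :=
  solvent (bads T E (grid d)) (edgs T E (grid d)) (E * grid d) n k h
    (2 * d) (q * width d) (q.+1 * width d).

(** The right half is taken without a test when the left one fails; [alive_split] justifies this. *)
Fixpoint digits (d : nat) : nat :=
  if d is d'.+1 then (2 * digits d' + ~~ alive d (2 * digits d'))%N else 0%N.

Lemma grid_gt0 d : (0 < grid d)%N.
Proof. by rewrite muln_gt0 expn_gt0 fact_gt0. Qed.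

(** This is the purpose of the factorial in [grid]; its factor [2 ^ d] puts the ends of the
    intervals of stage [d] on the grid. *)
Lemma octave_dvd_grid d i t : (i <= 2 * d + h)%N -> octave T i t ->
  (t %| grid d)%N.
Proof.
move=> id /and3P[_ ti i2t]; rewrite dvdn_mull // dvdn_fact //.
rewrite (leq_trans ti) ?leq_exp2l // andbT; lia.
Qed.

Variables (R : realFieldType) (C : nat).
Hypotheses (E_gt2 : (2 < E)%N) (n_gt0 : (0 < n)%N) (k_gt0 : (0 < k)%N).
Hypothesis T_sparse :
  forall i, (\sum_(0 <= t < (2 ^ i).+1) octave T i t <= C)%N.

Let rho : R := n%:R / n.+1%:R.
Let kappa : R := k%:R^-1.

Hypothesis p_le : C%:R * (2 / E%:R + kappa) <= (1 - rho) * rho ^+ h.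
Hypothesis kappa_large : (1 - rho) * 2 / 2 ^+ h <= kappa * (2 * rho - 1).
Hypothesis rho_large : 7 / 8 <= rho.
Hypothesis rho_h : 1 / 4 <= rho ^+ h.
Hypothesis slack_small : (1 - rho) * 2 / 2 ^+ h <= 1 / 8.

Let rho_gt0 : 0 < rho.
Proof. by apply: lt_le_trans rho_large; lra. Qed.

Let kappa_ge0 : 0 <= kappa.
Proof. by rewrite invr_ge0. Qed.

Let E_gt0 : (0 < E)%N.
Proof. exact: ltn_trans E_gt2. Qed.

Lemma alive0 : alive 0 0.
Proof.
rewrite /alive (solventE _ _ _ _ R) // expr0 divr1 mul0n mul1n.
have -> : width 0 = (4 * E * grid 0)%N by rewrite /width /grid mul1n.
apply: le_trans
  (initial_potential E_gt2 (grid_gt0 0) kappa_ge0 T_sparse rho_gt0 _ p_le).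
- by have := ler_wpM2r (ler0n R (E * grid 0)) rho_h; rewrite mulrCA; lra.
- by move=> i t ih; apply: octave_dvd_grid; rewrite muln0 ltnW.
Qed.

Lemma grid_potential_step G K l r : (0 < G)%N ->
    (forall i t, (i <= K + h)%N -> octave T i t -> (t %| G)%N) ->
  rho * potential (bads T E G) (edgs T E G) (E * G)%:R kappa rho h K l r
    - 1 / 8 * ((E * G)%:R / 2 ^+ K)
    <= potential (bads T E G) (edgs T E G) (E * G)%:R kappa rho h K.+1 l r.
Proof.
move=> G0 divG; have D0 : 0 < (E * G)%:R :> R by rewrite ltr0n muln_gt0 E_gt0.
have := @potential_step R (bads T E G) (edgs T E G) _ kappa rho h D0 kappa_ge0
  rho_gt0 (C%:R * (2 / E%:R + kappa)) K l r p_le kappa_large.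
move=> step; apply: le_trans (step _).
  by rewrite lerD2l lerN2 -[leLHS]mulrA ler_wpM2r // divr_ge0 ?exprn_ge0 // ltW.
apply: octave_enter => // j t; rewrite (maxn_idPr _) ?leq_addr //; exact: divG.
Qed.

(** Pass to the grid of stage [d.+1], process two octaves on the whole interval, and only then split
    it. With [x] the old threshold on the new grid, at least [x / 2] is left, while each half has to
    reach only [x / 4]. *)
Lemma alive_split d q : alive d q ->
  alive d.+1 (2 * q) || alive d.+1 (2 * q).+1.
Proof.
rewrite /alive !(solventE _ _ _ _ R) // => live.
have K1 : (2 * d + h <= 2 * d.+1 + h)%N by lia.
have K2 : ((2 * d).+1 + h <= 2 * d.+1 + h)%N by lia.
have KE : (2 * d.+1 = (2 * d).+2)%N by lia.
set G' := grid d.+1; set w' := width d.+1.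
pose F := (2 ^ (2 * d + h))`!%N; pose F' := (2 ^ (2 * d.+1 + h))`!%N.
have FF' : (F %| F')%N.
  rewrite /F' -(@bin_fact _ (2 ^ (2 * d + h))); last by rewrite leq_exp2l.
  by rewrite dvdn_mull // dvdn_mulr.
(* The ratio of the two grids: 2 from the powers of two, the rest from the factorials. *)
pose f := (2 * (F' %/ F))%N.
have F0 : (0 < F)%N by apply: fact_gt0.
have F'0 : (0 < F')%N by apply: fact_gt0.
have f0 : (0 < f)%N by rewrite /f muln_gt0 /= divn_gt0 //; apply: dvdn_leq.
have G'E : G' = (f * grid d)%N.
  by rewrite /G' /grid -/F -/F' -[in LHS](divnK FF') /f expnS; ring.
have w'E : (f * width d = 2 * w')%N.
  by rewrite /w' /width -/F -/F' -[in RHS](divnK FF') /f; ring.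
have G'0 : (0 < G')%N by apply: grid_gt0.
have dG i t : (i <= 2 * d + h)%N -> octave T i t -> (t %| grid d)%N.
  exact: octave_dvd_grid.
have dG' i t : (i <= 2 * d.+1 + h)%N -> octave T i t -> (t %| G')%N.
  exact: octave_dvd_grid.
pose U K l r := potential (bads T E G') (edgs T E G') (E * G')%:R kappa rho h K l r.
have UE : U (2 * d)%N (2 * q * w')%N ((2 * q).+2 * w')%N = f%:R *
    potential (bads T E (grid d)) (edgs T E (grid d)) (E * grid d)%:R kappa rho h
      (2 * d)%N (q * width d)%N (q.+1 * width d)%N.
  rewrite -(@potential_refine _ _ _ (bads T E G') (edgs T E G')) //.
  - have -> : f%:R * (E * grid d)%:R = (E * G')%:R :> R.
      by rewrite -natrM G'E mulnCA.
    by rewrite /U ![(f * (_ * width d))%N]mulnCA w'E; congr potential; ring.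
  - move=> i y s iK sf; apply: eq_bigr => t _.
    case oct: (octave T i t); rewrite ?mul0n // G'E.
    by rewrite (bad_refine E_gt2 (grid_gt0 d) (octave_gt0 oct) (dG _ _ (ltnW iK) oct)).
  - move=> i y s iK sf; rewrite /edgs big_distrr /=; apply: eq_bigr => t _.
    case oct: (octave T i t); rewrite ?mul0n ?muln0 // G'E.
    rewrite (edge_refine E_gt2 (grid_gt0 d) (octave_gt0 oct) (dG _ _ (ltnW iK) oct)) //.
    by case: (s == 0%N); rewrite /= ?mul1n ?mul0n.
set x := (E * G')%:R / 2 ^+ (2 * d) : R.
have x0 : 0 < x by rewrite divr_gt0 ?exprn_gt0 // ltr0n muln_gt0 E_gt0.
have live' : x <= U (2 * d)%N (2 * q * w')%N ((2 * q).+2 * w')%N.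
  rewrite UE /x G'E mulnCA natrM -mulrA ler_wpM2l //.
have step1 := @grid_potential_step G' (2 * d) (2 * q * w') ((2 * q).+2 * w') G'0.
have step2 := @grid_potential_step G' (2 * d).+1 (2 * q * w') ((2 * q).+2 * w') G'0.
have {}step1 := step1 (fun i t H => dG' i t (leq_trans H _)).
have {}step2 := step2 (fun i t H => dG' i t (leq_trans H _)).
move: (step1 K1) (step2 K2) => {step1 step2}; rewrite -!/(U _ _ _) -/x => s1 s2.
have xE : (E * G')%:R / 2 ^+ (2 * d.+1) = x / 4 :> R.
  by rewrite /x KE !exprS; field; rewrite expf_neq0.
have xE' : (E * G')%:R / 2 ^+ (2 * d).+1 = x / 2 :> R.
  by rewrite /x exprS; field; rewrite expf_neq0.
rewrite xE' in s2; rewrite !xE KE -!/(U _ _ _).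
have cat : U (2 * d).+2 (2 * q * w')%N ((2 * q).+2 * w')%N =
    U (2 * d).+2 (2 * q * w')%N ((2 * q).+1 * w')%N +
    U (2 * d).+2 ((2 * q).+1 * w')%N ((2 * q).+2 * w')%N.
  by apply: potential_cat; rewrite !leq_mul2r !leqnSn !orbT.
case: leP => //= lt1; rewrite leNgt; apply/negP => lt2.
have := two_decay_steps rho_large (ltW x0) live' s1 s2.
rewrite {}cat leNgt => /negP; apply; apply: (lt_le_trans (ltrD lt1 lt2)).
by rewrite -mulrDl ler_pdivrMr //; lra.
Qed.

Lemma alive_digits d : alive d (digits d).
Proof.
elim: d => [|d IHd]; first exact: alive0.
rewrite /=; have := alive_split IHd.
by case al: (alive d.+1 (2 * digits d)); rewrite /= ?addn0 ?addn1 ?al.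
Qed.

(** A positive potential forces a free cell, so every chosen interval still contains points that
    avoid the first [2 * d] octaves. *)
Lemma digits_free d : exists2 z, (digits d * width d <= z < (digits d).+1 * width d)%N &
  free (bads T E (grid d)) (2 * d) z.
Proof.
have := alive_digits d; rewrite /alive (solventE _ _ _ _ R) // => live.
apply: (@potential_gt0 R _ (edgs T E (grid d)) _ _ _ h); apply: lt_le_trans live.
by rewrite divr_gt0 ?exprn_gt0 // ltr0n muln_gt0 E_gt0 grid_gt0.
Qed.

End NestedIntervals.

(** * Recursive functions *)

Section RecursiveOnSequences.
Local Open Scope nat_scope.

(** Functions are written on plain sequences and matter only at length [n], so that arguments can be
    addressed by [nth] without dependent tuples. *)
Definition recS (n : nat) (f : seq nat -> nat) : Prop :=
  recursive (fun v : n.-tuple nat => f v).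

Lemma recS_ext n f g : (forall s, size s = n -> f s = g s) -> recS n f -> recS n g.
Proof.
move=> fg; rewrite /recS (_ : (fun v : n.-tuple nat => f v) = (fun v => g v)) //.
by apply/funext => v; apply: fg; rewrite size_tuple.
Qed.

Lemma recS_nth n i : i < n -> recS n (fun s => nth 0 s i).
Proof.
move=> lin; have := recursive_proj (Ordinal lin).
rewrite /recS; congr recursive; apply/funext => v.
by rewrite (tnth_nth 0).
Qed.

Lemma recS_comp n f (hs : seq (seq nat -> nat)) :
    recS (size hs) f -> (forall i, i < size hs -> recS n (nth (fun=> 0) hs i)) ->
  recS n (fun s => f [seq h s | h <- hs]).
Proof.
move=> rf rhs.
have := recursive_comp (h := fun (i : 'I_(size hs)) v => nth (fun=> 0) hs i (tval v)) rf
  (fun i => rhs i (ltn_ord i)).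
rewrite /recS; congr recursive; apply/funext => v; congr f.
apply: (@eq_from_nth _ 0); first by rewrite size_tuple size_map.
move=> i; rewrite size_tuple => ih.
by rewrite -(tnth_nth 0 _ (Ordinal ih)) tnth_mktuple (nth_map (fun=> 0)).
Qed.

Lemma recS_prec n f h g : recS n f -> recS n.+2 h ->
    (forall s, g (0 :: s) = f s) ->
    (forall k s, g (k.+1 :: s) = h [:: k, g (k :: s) & s]) ->
  recS n.+1 g.
Proof.
move=> rf rh g0 gS.
by apply: (recursive_prec (f := fun v => f (tval v)) (h := fun v => h (tval v))
   (g := fun v : n.+1.-tuple nat => g (tval v))) => // *; rewrite /= ?g0 ?gS.
Qed.

Lemma recS_comp1 n f a : recS 1 f -> recS n a -> recS n (fun s => f [:: a s]).
Proof. by move=> rf ra; apply: (@recS_comp n f [:: a]) => // -[]. Qed.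

Lemma recS_comp2 n f a b : recS 2 f -> recS n a -> recS n b ->
  recS n (fun s => f [:: a s; b s]).
Proof. by move=> rf ra rb; apply: (@recS_comp n f [:: a; b]) => // -[|[]]. Qed.

Lemma recS_comp3 n f a b c : recS 3 f -> recS n a -> recS n b -> recS n c ->
  recS n (fun s => f [:: a s; b s; c s]).
Proof.
by move=> rf ra rb rc; apply: (@recS_comp n f [:: a; b; c]) => // -[|[|[]]].
Qed.

Lemma recS_succ n a : recS n a -> recS n (fun s => (a s).+1).
Proof.
apply: (@recS_comp1 n (fun s => (nth 0 s 0).+1)).
have := recursive_succ; rewrite /recS; congr recursive; apply/funext => v.
by rewrite (tnth_nth 0).
Qed.

Lemma recS_const n k : recS n (fun=> k).
Proof.
by elim: k => [|k IHk]; [exact: recursive_zero | exact: recS_succ].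
Qed.

(** The leading arguments are recomputed and the last [n] are kept as parameters, which is the shape
    of the step of a primitive recursion. *)
Lemma recS_pre n f (hs : seq (seq nat -> nat)) k :
    recS (size hs + n) f ->
    (forall i, i < size hs -> recS (k + n) (nth (fun=> 0) hs i)) ->
  recS (k + n) (fun s => f ([seq h s | h <- hs] ++ drop k s)).
Proof.
move=> rf rhs.
pose ps := [seq (fun s : seq nat => nth 0 s (k + i)) | i <- iota 0 n].
have szps : size ps = n by rewrite size_map size_iota.
apply: (@recS_ext _ (fun s => f [seq h s | h <- hs ++ ps])).
  move=> s ss; rewrite map_cat; congr (f (_ ++ _)).
  apply: (@eq_from_nth _ 0); first by rewrite size_map szps size_drop ss addKn.
  move=> i; rewrite size_map szps => ip.
  rewrite (nth_map (fun=> 0)) ?szps // nth_drop /ps.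
  by rewrite (nth_map 0) ?size_iota // nth_iota.
apply: recS_comp; rewrite size_cat szps // => i ih; rewrite nth_cat.
case: ifP => [/rhs//|/negbT]; rewrite -leqNgt => hi.
rewrite (nth_map 0) ?size_iota; last by lia.
by rewrite nth_iota; [apply: recS_nth; lia | lia].
Qed.

Lemma recS_add n a b : recS n a -> recS n b -> recS n (fun s => a s + b s).
Proof.
apply: (@recS_comp2 n (fun s => nth 0 s 0 + nth 0 s 1)).
apply: (@recS_prec 1 (fun s => nth 0 s 0) (fun s => (nth 0 s 1).+1)) => //=.
- exact: recS_nth.
- exact/recS_succ/recS_nth.
Qed.

Lemma recS_sum n f b : recS n.+1 f -> recS n b ->
  recS n (fun s => \sum_(0 <= i < b s) f (i :: s)).
Proof.
move=> rf rb.
(* The bound becomes the first argument, on which the recursion runs; the step finds the parameters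
   behind the counter and the accumulator. *)
pose g (s : seq nat) := \sum_(0 <= i < nth 0 s 0) f (i :: drop 1 s).
have rg : recS n.+1 g.
  apply: (@recS_prec _ (fun=> 0)
    (fun s => nth 0 s 1 + f (nth 0 s 0 :: drop 2 s))).
  - exact: recS_const.
  - apply: recS_add; first exact: recS_nth.
    apply: (@recS_pre n f [:: fun s => nth 0 s 0] 2); first by rewrite add1n.
    by case=> //= _; apply: recS_nth.
  - by move=> s; rewrite /g big_geq.
  - by move=> k s; rewrite /g big_nat_recr //= drop0.
apply: (@recS_ext _ (fun s => g ([seq h s | h <- [:: b]] ++ drop 0 s))).
  by move=> s _; rewrite /g /= !drop0.
by apply: (@recS_pre n g [:: b] 0) => //= -[].
Qed.

Lemma recS_mul n a b : recS n a -> recS n b -> recS n (fun s => a s * b s).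
Proof.
apply: (@recS_comp2 n (fun s => nth 0 s 0 * nth 0 s 1)).
apply: (@recS_ext _ (fun s => \sum_(0 <= i < nth 0 s 0) nth 0 (i :: s) 2)).
  by move=> s _; rewrite /= sum_nat_const_nat subn0.
by apply: (@recS_sum 2 (fun s => nth 0 s 2)); apply: recS_nth.
Qed.

Lemma recS_prod n f b : recS n.+1 f -> recS n b ->
  recS n (fun s => \prod_(0 <= i < b s) f (i :: s)).
Proof.
move=> rf rb.
pose g (s : seq nat) := \prod_(0 <= i < nth 0 s 0) f (i :: drop 1 s).
have rg : recS n.+1 g.
  apply: (@recS_prec _ (fun=> 1)
    (fun s => nth 0 s 1 * f (nth 0 s 0 :: drop 2 s))).
  - exact: recS_const.
  - apply: recS_mul; first exact: recS_nth.
    apply: (@recS_pre n f [:: fun s => nth 0 s 0] 2); first by rewrite add1n.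
    by case=> //= _; apply: recS_nth.
  - by move=> s; rewrite /g big_geq.
  - by move=> k s; rewrite /g big_nat_recr //= drop0.
apply: (@recS_ext _ (fun s => g ([seq h s | h <- [:: b]] ++ drop 0 s))).
  by move=> s _; rewrite /g /= !drop0.
by apply: (@recS_pre n g [:: b] 0) => //= -[].
Qed.

Lemma recS_exp n a b : recS n a -> recS n b -> recS n (fun s => a s ^ b s).
Proof.
apply: (@recS_comp2 n (fun s => nth 0 s 0 ^ nth 0 s 1)).
apply: (@recS_ext _ (fun s => \prod_(0 <= i < nth 0 s 1) nth 0 (i :: s) 1)).
  by move=> s _; rewrite /= prod_nat_const_nat subn0.
by apply: (@recS_prod 2 (fun s => nth 0 s 1)); apply: recS_nth.
Qed.

Lemma recS_fact n a : recS n a -> recS n (fun s => (a s)`!).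
Proof.
apply: (@recS_comp1 n (fun s => (nth 0 s 0)`!)).
apply: (@recS_ext _ (fun s => \prod_(0 <= i < nth 0 s 0) (nth 0 (i :: s) 0).+1)).
  by move=> s _; rewrite fact_prod big_add1.
apply: (@recS_prod 1 (fun s => (nth 0 s 0).+1)); last exact: recS_nth.
exact/recS_succ/recS_nth.
Qed.

Lemma recS_is_zero n a : recS n a -> recS n (fun s => (a s == 0) : nat).
Proof.
apply: (@recS_comp1 n (fun s => (nth 0 s 0 == 0) : nat)).
apply: (@recS_prec 0 (fun=> 1) (fun=> 0)) => //; exact: recS_const.
Qed.

Lemma recS_sub n a b : recS n a -> recS n b -> recS n (fun s => a s - b s).
Proof.
have rp : recS 1 (fun s => (nth 0 s 0).-1).
  apply: (@recS_prec 0 (fun=> 0) (fun s => nth 0 s 0)) => //.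
  - exact: recS_const.
  - exact: recS_nth.
move=> ra rb.
(* The arguments are swapped because the recursion, which iterates the predecessor, runs on the
   subtrahend. *)
apply: (@recS_comp2 n (fun s => nth 0 s 1 - nth 0 s 0) b a) => //.
apply: (@recS_prec 1 (fun s => nth 0 s 0) (fun s => (nth 0 s 1).-1)) => /=.
- exact: recS_nth.
- by apply: (recS_comp1 rp); apply: recS_nth.
- by move=> s; rewrite subn0.
- by move=> k s; rewrite subnS.
Qed.

Lemma recS_leq n a b : recS n a -> recS n b -> recS n (fun s => (a s <= b s) : nat).
Proof. by move=> ra rb; apply/recS_is_zero/recS_sub. Qed.

Lemma recS_eq n a b : recS n a -> recS n b -> recS n (fun s => (a s == b s) : nat).
Proof.
move=> ra rb; apply: (@recS_ext _ (fun s => (a s <= b s) * (b s <= a s))).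
  by move=> s _; rewrite eqn_leq mulnb.
by apply: recS_mul; apply: recS_leq.
Qed.

(** The quotient is obtained as the number of [i < a] with [i.+1 * b <= a]. *)
Lemma recS_mod n a b : (forall s, 0 < b s) ->
  recS n a -> recS n b -> recS n (fun s => a s %% b s).
Proof.
move=> b0 ra rb.
pose d (s : seq nat) := \sum_(0 <= i < nth 0 s 0) (i.+1 * nth 0 s 1 <= nth 0 s 0).
have rd : recS 2 d.
  apply: (@recS_sum 2
    (fun s => ((nth 0 s 0).+1 * nth 0 s 2 <= nth 0 s 1) : nat)).
    by apply: recS_leq; [apply: recS_mul; [apply: recS_succ|] |]; apply: recS_nth.
  exact: recS_nth.
apply: (@recS_ext _ (fun s => a s - d [:: a s; b s] * b s)); last first.
  by apply: recS_sub => //; apply: recS_mul => //; apply: recS_comp2.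
move=> s _; rewrite /d /=.
suff -> : \sum_(0 <= i < a s) (i.+1 * b s <= a s) = a s %/ b s.
  by rewrite {1}(divn_eq (a s) (b s)) addKn.
rewrite (big_cat_nat (n := a s %/ b s)) ?leq_div //= big_nat.
rewrite (eq_bigr (fun=> 1)); last first.
  by move=> i /andP[_]; rewrite leq_divRL // => ->.
rewrite -big_nat sum_nat_const_nat subn0 muln1 big_nat big1 ?addn0 //.
by move=> i /andP[di _]; rewrite -leq_divRL // leqNgt ltnS di.
Qed.

End RecursiveOnSequences.

(** * Computability of the digits *)

Section RecursiveDigits.
Local Open Scope nat_scope.
Variables (T : nat -> bool) (E n k h : nat).
Hypothesis E_gt0 : 0 < E.
Hypothesis T_rec : recS 1 (fun s => T (nth 0 s 0)).

Lemma recS_octave m a c : recS m a -> recS m c ->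
  recS m (fun s => octave T (a s) (c s)).
Proof.
move=> ra rc; apply: (@recS_ext _ (fun s =>
  T (c s) * ((c s <= 2 ^ a s) * ((2 ^ a s).+1 <= 2 * c s)))).
  by move=> s _; rewrite /octave !mulnb.
apply: recS_mul; first exact: (recS_comp1 T_rec).
by apply: recS_mul; apply: recS_leq; rewrite //;
  [exact: recS_exp (recS_const _ _) _ |
   exact: recS_succ (recS_exp (recS_const _ _) _) |
   exact: recS_mul (recS_const _ _) _].
Qed.

Lemma recS_grid m a : recS m a -> recS m (fun s => grid h (a s)).
Proof.
move=> ra; apply: recS_mul; first exact: recS_exp (recS_const _ _) _.
apply/recS_fact/recS_exp; first exact: recS_const.
by apply: recS_add (recS_const _ _); apply: recS_mul (recS_const _ _) _.
Qed.

Lemma recS_width m a : recS m a -> recS m (fun s => width E h (a s)).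
Proof.
move=> ra; apply: recS_mul; first exact: recS_const.
apply/recS_fact/recS_exp; first exact: recS_const.
by apply: recS_add (recS_const _ _); apply: recS_mul (recS_const _ _) _.
Qed.

Lemma recS_cell_mod m a t z : recS m a -> recS m t -> recS m z ->
  recS m (fun s => (t s * z s + grid h (a s)) %% (E * grid h (a s))).
Proof.
move=> ra rt rz; apply: recS_mod.
- by move=> s; rewrite muln_gt0 E_gt0 grid_gt0.
- by apply: recS_add; [apply: recS_mul|apply: recS_grid].
- by apply: recS_mul; [exact: recS_const|apply: recS_grid].
Qed.

Lemma recS_bads m a i z : recS m a -> recS m i -> recS m z ->
  recS m (fun s => bads T E (grid h (a s)) (i s) (z s)).
Proof.
apply: (@recS_comp3 m (fun s =>
  bads T E (grid h (nth 0 s 0)) (nth 0 s 1) (nth 0 s 2))).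
(* The summation variable comes first: positions 0 to 3 hold the denominator, the stage, the octave
   and the cell. *)
apply: (@recS_sum 3 (fun s => octave T (nth 0 s 2) (nth 0 s 0) *
   bad E (grid h (nth 0 s 1)) (nth 0 s 0) (nth 0 s 3))).
  apply: recS_mul; first by apply: recS_octave; apply: recS_nth.
  apply: recS_leq.
    by apply: recS_succ; apply: recS_cell_mod; apply: recS_nth.
  by apply: recS_mul; [exact: recS_const | apply/recS_grid/recS_nth].
by apply/recS_succ/recS_exp; [exact: recS_const | exact: recS_nth].
Qed.

Lemma recS_edgs m a i z : recS m a -> recS m i -> recS m z ->
  recS m (fun s => edgs T E (grid h (a s)) (i s) (z s)).
Proof.
apply: (@recS_comp3 m (fun s =>
  edgs T E (grid h (nth 0 s 0)) (nth 0 s 1) (nth 0 s 2))).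
apply: (@recS_sum 3 (fun s => octave T (nth 0 s 2) (nth 0 s 0) *
   edge E (grid h (nth 0 s 1)) (nth 0 s 0) (nth 0 s 3))).
  apply: recS_mul; first by apply: recS_octave; apply: recS_nth.
  apply: recS_eq; first by apply: recS_cell_mod; apply: recS_nth.
  by apply: recS_mul; [exact: recS_const | apply/recS_grid/recS_nth].
by apply/recS_succ/recS_exp; [exact: recS_const | exact: recS_nth].
Qed.

Lemma recS_free m a z : recS m a -> recS m z ->
  recS m (fun s => free (bads T E (grid h (a s))) (2 * a s) (z s)).
Proof.
apply: (@recS_comp2 m (fun s =>
  free (bads T E (grid h (nth 0 s 0))) (2 * nth 0 s 0) (nth 0 s 1))).
apply: recS_is_zero; apply: (@recS_sum 2 (fun s =>
  bads T E (grid h (nth 0 s 1)) (nth 0 s 0) (nth 0 s 2))).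
  by apply: recS_bads; apply: recS_nth.
by apply: recS_mul; [exact: recS_const | exact: recS_nth].
Qed.

Lemma recS_edges m a z : recS m a -> recS m z ->
  recS m (fun s => edges (edgs T E (grid h (a s))) (2 * a s) (z s)).
Proof.
apply: (@recS_comp2 m (fun s =>
  edges (edgs T E (grid h (nth 0 s 0))) (2 * nth 0 s 0) (nth 0 s 1))).
apply: (@recS_sum 2 (fun s =>
  edgs T E (grid h (nth 0 s 1)) (nth 0 s 0) (nth 0 s 2))).
  by apply: recS_edgs; apply: recS_nth.
by apply: recS_mul; [exact: recS_const | exact: recS_nth].
Qed.

Lemma recS_gain m a : recS m a -> recS m (fun s => gain n k h (2 * a s)).
Proof.
move=> ra; apply: recS_mul (recS_const _ _).
apply: recS_mul; first exact: recS_const.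
apply: recS_exp; first exact: recS_const.
by apply: recS_add (recS_const _ _); apply: recS_mul (recS_const _ _) _.
Qed.

Lemma recS_debt m a z : recS m a -> recS m z ->
  recS m (fun s => debt (bads T E (grid h (a s))) (edgs T E (grid h (a s)))
    (E * grid h (a s)) n k h (2 * a s) (z s)).
Proof.
apply: (@recS_comp2 m (fun s => debt (bads T E (grid h (nth 0 s 0)))
  (edgs T E (grid h (nth 0 s 0))) (E * grid h (nth 0 s 0)) n k h
  (2 * nth 0 s 0) (nth 0 s 1))).
have r0 : recS 2 (fun s => nth 0 s 0) by apply: recS_nth.
have r1 : recS 2 (fun s => nth 0 s 1) by apply: recS_nth.
apply: recS_add.
  apply: recS_mul; last exact: recS_edges.
  do 2 apply: recS_mul (recS_const _ _).
  by apply: recS_mul; [exact: recS_const | exact: recS_grid].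
apply: (@recS_sum 2 (fun s => n.+1 ^ (nth 0 s 0).+1 * n ^ (h - (nth 0 s 0).+1) *
  (k * 2 ^ (2 * nth 0 s 1 + h) *
     bads T E (grid h (nth 0 s 1)) (2 * nth 0 s 1 + nth 0 s 0) (nth 0 s 2) +
   E * grid h (nth 0 s 1) * 2 ^ (h - nth 0 s 0) *
     edgs T E (grid h (nth 0 s 1)) (2 * nth 0 s 1 + nth 0 s 0) (nth 0 s 2))));
  last exact: recS_const.
have {}r0 : recS 3 (fun s => nth 0 s 0) by apply: recS_nth.
have {}r1 : recS 3 (fun s => nth 0 s 1) by apply: recS_nth.
have r2 : recS 3 (fun s => nth 0 s 2) by apply: recS_nth.
have rK : recS 3 (fun s => 2 * nth 0 s 1) by apply: recS_mul => //; apply: recS_const.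
have rKj : recS 3 (fun s => 2 * nth 0 s 1 + nth 0 s 0) by apply: recS_add.
apply: recS_mul; first apply: recS_mul.
- by apply: recS_exp; [exact: recS_const | exact: recS_succ].
- apply: recS_exp; first exact: recS_const.
  by apply: recS_sub; [exact: recS_const | exact: recS_succ].
apply: recS_add; apply: recS_mul.
- apply: recS_mul; first exact: recS_const.
  apply: recS_exp; first exact: recS_const.
  by apply: recS_add => //; apply: recS_const.
- exact: recS_bads.
- apply: recS_mul; first by apply: recS_mul; [exact: recS_const|exact: recS_grid].
  apply: recS_exp; first exact: recS_const.
  by apply: recS_sub => //; apply: recS_const.
- exact: recS_edgs.
Qed.

Lemma recS_alive m a c : recS m a -> recS m c ->
  recS m (fun s => alive T E n k h (a s) (c s)).
Proof.
apply: (@recS_comp2 m (fun s => alive T E n k h (nth 0 s 0) (nth 0 s 1))).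
(* [recS_sum] covers sums starting at 0, so the cells are numbered from the left end of the
   interval. *)
have shift (F : nat -> nat) q w :
    \sum_(q * w <= z < q.+1 * w) F z = \sum_(0 <= i < w) F (q * w + i).
  rewrite mulSn -{1}[q * w]add0n big_addn addnK.
  by apply: eq_bigr => i _; rewrite addnC.
apply: (@recS_ext _ (fun s =>
  \sum_(0 <= i < width E h (nth 0 s 0))
     free (bads T E (grid h (nth 0 s 0))) (2 * nth 0 s 0)
       (nth 0 s 1 * width E h (nth 0 s 0) + i) *
     debt (bads T E (grid h (nth 0 s 0))) (edgs T E (grid h (nth 0 s 0)))
       (E * grid h (nth 0 s 0)) n k h (2 * nth 0 s 0)
       (nth 0 s 1 * width E h (nth 0 s 0) + i) +
     E * grid h (nth 0 s 0) * (k * 2 ^ h * n ^ h) <=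
  \sum_(0 <= i < width E h (nth 0 s 0))
     free (bads T E (grid h (nth 0 s 0))) (2 * nth 0 s 0)
       (nth 0 s 1 * width E h (nth 0 s 0) + i) *
     gain n k h (2 * nth 0 s 0))).
  by move=> s _; rewrite /alive /solvent !shift.
have r0 : recS 2 (fun s => nth 0 s 0) by apply: recS_nth.
have r1 : recS 3 (fun s => nth 0 s 1) by apply: recS_nth.
have rz : recS 3 (fun s => nth 0 s 2 * width E h (nth 0 s 1) + nth 0 s 0).
  apply: recS_add; last exact: recS_nth.
  by apply: recS_mul; [exact: recS_nth | exact: recS_width].
apply: recS_leq.
  apply: recS_add.
    apply: (@recS_sum 2 (fun s =>
      free (bads T E (grid h (nth 0 s 1))) (2 * nth 0 s 1)
        (nth 0 s 2 * width E h (nth 0 s 1) + nth 0 s 0) *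
      debt (bads T E (grid h (nth 0 s 1))) (edgs T E (grid h (nth 0 s 1)))
        (E * grid h (nth 0 s 1)) n k h (2 * nth 0 s 1)
        (nth 0 s 2 * width E h (nth 0 s 1) + nth 0 s 0))).
      by apply: recS_mul; [exact: recS_free | exact: recS_debt].
    exact: recS_width.
  apply: recS_mul (recS_const _ _).
  by apply: recS_mul; [exact: recS_const | exact: recS_grid].
apply: (@recS_sum 2 (fun s =>
  free (bads T E (grid h (nth 0 s 1))) (2 * nth 0 s 1)
    (nth 0 s 2 * width E h (nth 0 s 1) + nth 0 s 0) *
  gain n k h (2 * nth 0 s 1))).
  by apply: recS_mul; [exact: recS_free | exact: recS_gain].
exact: recS_width.
Qed.

Lemma recS_digits m a : recS m a -> recS m (fun s => digits T E n k h (a s)).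
Proof.
apply: (@recS_comp1 m (fun s => digits T E n k h (nth 0 s 0))).
apply: (@recS_prec 0 (fun=> 0) (fun s =>
  2 * nth 0 s 1 +
  ((alive T E n k h (nth 0 s 0).+1 (2 * nth 0 s 1) : nat) == 0))) => //.
- exact: recS_const.
- have r1 : recS 2 (fun s => 2 * nth 0 s 1).
    by apply: recS_mul; [exact: recS_const | exact: recS_nth].
  apply: recS_add => //; apply: recS_is_zero; apply: recS_alive => //.
  exact/recS_succ/recS_nth.
- by move=> j s /=; rewrite eqb0.
Qed.

End RecursiveDigits.

(** * Numerical bounds and the limit point *)

Section PowerBounds.
Local Open Scope nat_scope.

Lemma expn_succ_ge N m : N ^ m.+1 + m.+1 * N ^ m <= N.+1 ^ m.+1.
Proof.
elim: m => [|m IHm]; first by rewrite !expn1 expn0; lia.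
rewrite ![_ ^ m.+2]expnS; have := leq_mul (leqnn N.+1) IHm.
rewrite ![_ ^ m.+1]expnS; lia.
Qed.

(** The stronger bound on [(1 + 1 / n) ^ (n + 1)] is inductive, as this sequence decreases; it holds
    at [n = 7] by computation. *)
Lemma expn_succ_le3 n : 7 <= n -> n.+1 ^ n <= 3 * n ^ n.
Proof.
move=> n7; suff : n.+1 ^ n.+1 <= 3 * n ^ n.+1.
  rewrite !expnS; move: (_ ^ _) (_ ^ _) => x y; nia.
elim: n n7 => // n IHn; rewrite leq_eqVlt => /orP[/eqP<-|n7].
  by vm_compute.
have {}IHn := IHn n7; have n0 : 0 < n by lia.
(* The Bernoulli inequality at [n * (n + 2) = (n + 1) ^ 2 - 1] compares consecutive terms of the
   sequence. *)
have NE : (n * n.+2).+1 = n.+1 * n.+1 by lia.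
have := expn_succ_ge (n * n.+2) n; rewrite NE !expnMn => bern.
have x0 : 0 < n ^ n.+1 by rewrite expn_gt0 n0.
rewrite -(leq_pmul2r x0).
apply: (@leq_trans (n.+1 ^ n.+2 * n.+1 ^ n.+1)); last first.
  by rewrite [3 * _]mulnC -mulnA leq_mul2l IHn orbT.
rewrite [n.+2 ^ _]expnS [n.+1 ^ n.+2]expnS.
move: bern; rewrite ![n.+2 ^ n.+1]expnS ![n ^ n.+1]expnS.
move: (n ^ n) (n.+2 ^ n) (n.+1 ^ n.+1) => a c d bern.
have : n.+1 * (n * a * (n.+2 * c) + n.+1 * (a * c)) <= n.+1 * (d * d).
  by rewrite leq_mul2l bern.
nia.
Qed.

End PowerBounds.

Lemma nested_limit (R : realType) (a : nat -> nat) :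
    (forall d, (2 * a d <= a d.+1 <= (2 * a d).+1)%N) ->
  exists x : R, forall d,
    4 * (a d)%:R / 2 ^+ d <= x <= 4 * (a d).+1%:R / 2 ^+ d.
Proof.
move=> aS.
have a_add d m : (2 ^ m * a d <= a (d + m)%N < 2 ^ m * (a d).+1)%N.
  elim: m => [|m IHm]; first by rewrite addn0 !mul1n ltnSn leqnn.
  by rewrite addnS !expnS; have := aS (d + m)%N; lia.
pose lo d : R := 4 * (a d)%:R / 2 ^+ d; pose hi d : R := 4 * (a d).+1%:R / 2 ^+ d.
have p2 m : 0 < 2 ^+ m :> R by rewrite exprn_gt0.
have lo_add d m : lo d <= lo (d + m)%N.
  rewrite /lo ler_pdivrMr // mulrAC ler_pdivlMr // exprD -!mulrA ler_pM2l //.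
  have : (2 ^ m * a d)%:R <= (a (d + m)%N)%:R :> R.
    by rewrite ler_nat; case/andP: (a_add d m).
  rewrite natrM natrX => /(ler_wpM2r (ltW (p2 d))); apply: le_trans.
  by rewrite le_eqVlt; apply/orP; left; apply/eqP; ring.
have hi_add d m : hi (d + m)%N <= hi d.
  rewrite /hi ler_pdivrMr // mulrAC ler_pdivlMr // exprD -!mulrA ler_pM2l //.
  have : (a (d + m)%N).+1%:R <= (2 ^ m * (a d).+1)%:R :> R.
    by rewrite ler_nat; case/andP: (a_add d m).
  rewrite natrM natrX => /(ler_wpM2r (ltW (p2 d))) /le_trans; apply.
  by rewrite le_eqVlt; apply/orP; left; apply/eqP; ring.
have lohi d d' : lo d <= hi d'.
  apply: (le_trans (lo_add d d')); apply: (@le_trans _ _ (hi (d + d')%N)).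
    by rewrite /lo /hi ler_wpM2r ?invr_ge0 ?(ltW (p2 _)) // ler_wpM2l // ler_nat.
  by rewrite addnC.
exists (sup (range lo)) => d; apply/andP; split.
  apply: ub_le_sup; last by exists d.
  by exists (hi 0%N) => _ [d' _ <-]; exact: lohi.
apply: ge_sup => [|_ [d' _ <-]]; last exact: lohi.
by exists (lo 0%N); exists 0%N.
Qed.

Lemma octave_exists (t : nat) : (0 < t)%N -> exists i, (t <= 2 ^ i < 2 * t)%N.
Proof.
case: (ltngtP t 1) => [| t1 _|-> _]; [by case: t | | by exists 0%N].
have := up_log_bounds (isT : (1 < 2)%N) t1 => /=.
set k := up_log 2 t => /andP[kt tk]; exists k; rewrite tk /=.
have k0 : (0 < k)%N by rewrite up_log_gt0.
by rewrite -(prednK k0) expnS ltn_mul2l.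
Qed.

(** Octave [i] lies in the dyadic interval of index [i - 1]; for [i = 0] this uses the index
    [-1]. *)
Lemma sparse_octaves (R : realType) (C : nat) (T : set nat) :
    (forall j : int, T `&` dyadic_interval R j #<= `I_C) ->
  forall i, (\sum_(0 <= t < (2 ^ i).+1) octave (fun t => `[< T t >]) i t <= C)%N.
Proof.
move=> T_sparse i; set P := octave _ i.
have /pcard_leP/unsquash f := T_sparse (i%:Z - 1).
pose s := [seq t <- index_iota 0 (2 ^ i).+1 | P t].
have -> : (\sum_(0 <= t < (2 ^ i).+1) P t = size s)%N.
  rewrite size_filter -sum1_count [RHS]big_mkcond; apply: eq_bigr => t _.
  by case: (P t).
have sS t : t \in s -> (T `&` dyadic_interval R (i%:Z - 1)) t.
  rewrite mem_filter => /andP[/and3P[/asboolP Tt ti it] _]; split => //.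
  rewrite /dyadic_interval /= subrK -exprnP -natrX ler_nat ti andbT.
  rewrite exprzDr ?unitfE // -exprnP exprN1 ltr_pdivrMr // -natrX -natrM ltr_nat.
  by rewrite mulnC.
rewrite -(size_map f) -[leqRHS](size_iota 0); apply: uniq_leq_size.
  rewrite map_inj_in_uniq ?filter_uniq ?iota_uniq // => t u ts us.
  by apply: 'inj_f; rewrite inE; apply: sS.
move=> _ /mapP[t ts ->]; rewrite mem_iota add0n.
exact: (@funS _ _ _ _ f _ (sS _ ts)).
Qed.

Lemma not_bad_dist (R : realType) (E G t z : nat) (j : int) :
    (2 < E)%N -> (0 < G)%N -> ~~ bad E G t z ->
  E%:R^-1 <= `|t%:R * (z%:R / (E * G)%:R) - j%:~R| :> R.
Proof.
move=> E2 G0 nb.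
have D0 : 0 < (E * G)%:R :> R by rewrite ltr0n muln_gt0 G0 andbT; lia.
have E0 : 0 < E%:R :> R by rewrite ltr0n; lia.
have -> : t%:R * (z%:R / (E * G)%:R) - j%:~R =
    (t%:R * z%:R - j%:~R * (E * G)%:R) / (E * G)%:R :> R.
  by rewrite mulrBl mulfK ?gt_eqF // mulrA.
rewrite normrM normfV (gtr0_norm D0) ler_pdivlMr //.
have -> : E%:R^-1 * (E * G)%:R = G%:R :> R.
  by rewrite natrM mulKf ?gt_eqF.
have -> : t%:R * z%:R - j%:~R * (E * G)%:R =
    ((t * z)%:Z - j * (E * G)%:Z)%:~R :> R.
  by rewrite intrB intrM -!pmulrn !natrM.
rewrite -intr_norm -[G%:R]/(G%:Z%:~R) ler_int.
(* For negative [j] the difference is already at least [E * G]. *)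
case: j => j; last first.
  by rewrite NegzE; nia.
have [] := not_bad_far j E2 G0 nb; lia.
Qed.

(* The tight inequality is the first: it needs [2 / 63 + 1 / 102 <= 1 / 24], the
   bound [(1 - 1 / m) ^ (m - 1) >= 1 / 3] being applied with [m = 8 l]. *)
Lemma parameters (R : realFieldType) (C l : nat) : (0 < l)%N -> (0 < C)%N ->
    (C < 2 ^ l.+1)%N ->
  let n := (8 * l).-1 in
  let rho : R := n%:R / n.+1%:R in
  let kappa : R := (102 * C * l)%:R^-1 in
  [/\ C%:R * (2 / (63 * C * l)%:R + kappa) <= (1 - rho) * rho ^+ n,
      (1 - rho) * 2 / 2 ^+ n <= kappa * (2 * rho - 1),
      7 / 8 <= rho, 1 / 4 <= rho ^+ n &
      (1 - rho) * 2 / 2 ^+ n <= 1 / 8].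
Proof.
move=> l0 C0 C_lt n rho kappa.
have n7 : (7 <= n)%N by rewrite /n; lia.
have nE : n.+1 = (8 * l)%N by rewrite /n; lia.
have l1 : 1 <= l%:R :> R by rewrite ler1n.
have L0 : 0 < l%:R :> R by rewrite ltr0n.
have c0 : 0 < C%:R :> R by rewrite ltr0n.
have rhoE : rho = 1 - (8 * l%:R)^-1.
  have -> : rho = (n.+1%:R - 1) / n.+1%:R by rewrite /rho -natr1 addrK.
  by rewrite mulrBl divff ?pnatr_eq0 // mul1r nE natrM.
have inv_le : (8 * l%:R)^-1 <= 1 / 8 :> R.
  by rewrite mul1r lef_pV2 ?posrE ?mulr_gt0 //; lra.
have inv_gt0 : 0 < (8 * l%:R)^-1 :> R by rewrite invr_gt0 mulr_gt0.
have rho_third : 1 / 3 <= rho ^+ n.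
  rewrite /rho expr_div_n ler_pdivlMr ?exprn_gt0 ?ltr0n //.
  rewrite mulrAC ler_pdivrMr // mul1r -!natrX -natrM ler_nat mulnC.
  exact: expn_succ_le3.
(* The second inequality needs this: with [2 * rho - 1 >= 3 / 4] it asks for
   [102 * C * 4 / 3 <= 2 * 2 ^ (8 * l)]. *)
have pow : (68 * C <= 2 ^ (8 * l))%N.
  move: C_lt; rewrite expnS [(8 * l)%N]mulnC expnM.
  case: (ltngtP l 1) => [|l2|->]; [by lia | | by rewrite expn1 /=; lia].
  have : (2 ^ 2 <= 2 ^ l)%N by rewrite leq_exp2l.
  move: (2 ^ l)%N => y y4 Cy; apply: (@leq_trans (136 * y)%N); first by lia.
  rewrite expnSr leq_mul2r; apply/orP; right.
  by apply: (@leq_trans (4 ^ 7)%N); last by rewrite leq_exp2r.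
have p2 : 2 ^+ n = 2 ^+ (8 * l) / 2 :> R by rewrite -nE exprSr mulfK.
have big2 : 0 < 2 ^+ (8 * l) :> R by rewrite exprn_gt0.
have powR : 68 * C%:R <= 2 ^+ (8 * l) :> R by rewrite -natrX -natrM ler_nat.
have slackE : (1 - rho) * 2 / 2 ^+ n = (l%:R * 2 * 2 ^+ (8 * l))^-1.
  by rewrite p2 rhoE; field; rewrite !gt_eqF.
split.
- apply: (@le_trans _ _ ((8 * l%:R)^-1 * (1 / 3))); last first.
    by rewrite rhoE opprB addrC subrK ler_wpM2l // -?rhoE // ltW.
  have -> : C%:R * (2 / (63 * C * l)%:R + kappa) = (2 / 63 + 1 / 102) / l%:R.
    by rewrite /kappa !natrM; field; rewrite !gt_eqF.
  have -> : (8 * l%:R)^-1 * (1 / 3) = (1 / 24) / l%:R :> R.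
    by field; rewrite gt_eqF.
  by rewrite ler_wpM2r ?invr_ge0 ?ltW //; lra.
- rewrite slackE /kappa.
  apply: (@le_trans _ _ ((102 * C * l)%:R^-1 * (3 / 4))); last first.
    by rewrite ler_wpM2l ?invr_ge0 // rhoE; lra.
  rewrite [leRHS]mulrC ler_pdivlMr ?ltr0n ?muln_gt0 ?C0 // [leLHS]mulrC ler_pdivrMr.
    rewrite !natrM; have := ler_wpM2r (ltW L0) powR; lra.
  by rewrite !mulr_gt0.
- rewrite rhoE; lra.
- by apply: le_trans rho_third; lra.
- rewrite slackE mul1r lef_pV2 ?posrE ?mulr_gt0 //.
  have c1 : 1 <= C%:R :> R by rewrite ler1n.
  have b68 : 68 <= 2 ^+ (8 * l) :> R by apply: le_trans powR; lra.
  have := ler_pM ler01 (ler0n _ 68) l1 b68; lra.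
Qed.

(** The gap between 63 and 64 makes the inequality strict; rounding the logarithm down goes in the
    right direction. *)
Lemma eps_lt (R : realType) (C : nat) : (2 <= C)%N ->
  1 / (64 * C%:R * log2 C%:R) < (63 * C * trunc_log 2 C)%:R^-1 :> R.
Proof.
move=> C2; set l := trunc_log 2 C.
have l0 : (0 < l)%N by rewrite trunc_log_gt0.
have lC : (2 ^ l <= C)%N by rewrite trunc_logP //; lia.
have ln2 : 0 < ln 2 :> R by rewrite ln_gt0 // ltr1n.
have l_le : l%:R <= log2 C%:R :> R.
  rewrite /log2 ler_pdivlMr // mulr_natl -lnXn // ler_ln ?posrE ?exprn_gt0 //.
    by rewrite -natrX ler_nat.
  by rewrite ltr0n; lia.
have c0 : 0 < C%:R :> R by rewrite ltr0n; lia.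
have l0' : 0 < l%:R :> R by rewrite ltr0n.
have log0 : 0 < log2 C%:R :> R := lt_le_trans l0' l_le.
move: (log2 _) l_le log0 => x l_le x0; rewrite mul1r !natrM ltf_pV2 ?posrE ?mulr_gt0 //.
apply: (@lt_le_trans _ _ (64 * C%:R * l%:R)).
  by rewrite !ltr_pM2r // ltr_nat.
by rewrite ler_wpM2l // mulr_ge0 // ltW.
Qed.

(** * Regularity and computability of the limit point *)

Theorem theorem9 (R : realType) (C : nat) (T : set nat)
    (C_ge2 : (2 <= C)%N)
    (T_pos : forall t, T t -> (0 < t)%N)
    (T_sparse : forall j : int, T `&` dyadic_interval R j #<= `I_C) :
  let eps : R := 1 / (64 * C%:R * log2 C%:R) in
  (exists theta : R, forall t, T t -> eps_regular eps t theta) /\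
  (computable_set T ->
   exists theta : R,
     computable_real theta /\ forall t, T t -> eps_regular eps t theta).
Proof.
move=> eps.
(* Here [m = 8 * l], and [n = m - 1] serves both as the numerator of [rho] and as the look-ahead
   [h]. *)
pose l := trunc_log 2 C; pose E := (63 * C * l)%N; pose k := (102 * C * l)%N.
pose n := (8 * l).-1; pose Tb t := `[< T t >].
have l0 : (0 < l)%N by rewrite trunc_log_gt0.
have C0 : (0 < C)%N by apply: leq_trans C_ge2.
have Cl : (C < 2 ^ l.+1)%N by apply: trunc_log_ltn.
have n0 : (0 < n)%N by rewrite /n; lia.
have k0 : (0 < k)%N by rewrite !muln_gt0 C0.
have Cl0 : (0 < C * l)%N by rewrite muln_gt0 C0.
have E2 : (2 < E)%N by rewrite /E -mulnA; lia.
have E0 : (0 < E)%N by apply: ltn_trans E2.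
have [h1 h2 h3 h4 h5] := parameters R l0 C0 Cl.
pose a := digits Tb E n k n.
have freeP := digits_free E2 n0 k0 (sparse_octaves T_sparse) h1 h2 h3 h4 h5.
have [theta thetaP] : exists x : R, forall d,
    4 * (a d)%:R / 2 ^+ d <= x <= 4 * (a d).+1%:R / 2 ^+ d.
  apply: nested_limit => d; rewrite /a /=.
  by case: (alive _ _ _ _ _ _ _); rewrite ?addn0 ?addn1 leqnn leqnSn.
have regular t : T t -> eps_regular eps t theta.
  move=> Tt; have [i ti] := octave_exists (T_pos t Tt).
  have oct : octave Tb i t by rewrite /octave ti andbT; apply/asboolP.
  (* As [eps] is strictly below [1 / E], it is enough to bound each distance below by [1 / E] up to
     an arbitrary error [e]. *)
  apply: (lt_le_trans (eps_lt R C_ge2)); apply: lb_le_inf.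
    by exists `|t%:R * theta - 0%:~R|; exists 0.
  move=> _ [j _ <-]; apply/ler_addgt0Pr => e e0.
  (* At this stage octave [i] has been removed, as [i < 2 * d], and [t * (4 / 2 ^ d)] is below
     [e]. *)
  pose d := maxn i.+1 (Num.Def.archi_bound (4 * t%:R / e)).
  have [z zI fz] := freeP d.
  have nb : ~~ bad E (grid n d) t z.
    by apply: free_not_bad oct fz; rewrite /d; lia.
  have far := not_bad_dist R j E2 (grid_gt0 n d) nb.
  have D0 : 0 < (E * grid n d)%:R :> R by rewrite ltr0n muln_gt0 E0 grid_gt0.
  have p2 : 0 < 2 ^+ d :> R by rewrite exprn_gt0.
  have wE : (width E n d)%:R = 4 * (E * grid n d)%:R / 2 ^+ d :> R.
    by rewrite /width /grid !natrM natrX; field; rewrite gt_eqF.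
  (* Both points lie in the interval of stage [d], whose length is [4 / 2 ^ d]. *)
  have near : `|theta - z%:R / (E * grid n d)%:R| <= 4 / 2 ^+ d.
    have /andP[z1 z2] := zI; have /andP[x1 x2] := thetaP d.
    have {}z1 : 4 * (a d)%:R / 2 ^+ d <= z%:R / (E * grid n d)%:R :> R.
      rewrite ler_pdivlMr //; move: z1; rewrite -(ler_nat R) natrM wE.
      by apply: le_trans; rewrite le_eqVlt; apply/orP; left; apply/eqP; ring.
    have {}z2 : z%:R / (E * grid n d)%:R <= 4 * (a d).+1%:R / 2 ^+ d :> R.
      rewrite ler_pdivrMr //; move/ltnW: z2; rewrite -(ler_nat R) natrM wE.
      by move/le_trans; apply; rewrite le_eqVlt; apply/orP; left; apply/eqP; ring.
    move: x2 z2; rewrite -[(a d).+1%:R]natr1 mulrDr mulr1 mulrDl => x2 z2.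
    by rewrite ler_norml; lra.
  apply: (le_trans far).
  have -> : t%:R * (z%:R / (E * grid n d)%:R) - j%:~R =
      (t%:R * theta - j%:~R) - t%:R * (theta - z%:R / (E * grid n d)%:R) by ring.
  apply: (le_trans (ler_normB _ _)); rewrite lerD2l normrM ger0_norm //.
  apply: (le_trans (ler_wpM2l (ler0n _ t) near)).
  rewrite mulrCA mulrA ler_pdivrMr // [leRHS]mulrC -ler_pdivrMr // ltW //.
  by apply: upper_nthrootP; rewrite leq_maxr.
split; first by exists theta.
move=> T_comp; exists theta; split => //.
have T_rec : recS 1 (fun s => Tb (nth 0%N s 0)).
  rewrite /recS; move: T_comp; rewrite /computable_set /computable_fun.
  by congr recursive; apply/funext => v; rewrite (tnth_nth 0%N).
have compS (f : nat -> nat) : recS 1 (fun s => f (nth 0%N s 0)) -> computable_fun f.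
  by rewrite /recS /computable_fun; congr recursive; apply/funext => v;
    rewrite (tnth_nth 0%N).
(* Two extra stages absorb the initial length 4: the interval of stage [d.+2] has length [2 ^- d]
   and left end [a d.+2 / 2 ^ d], which is nonnegative, so the sign exponent is 0. *)
exists (fun=> 0%N), (fun d => a d.+2), (fun d => 2 ^ d)%N; split.
- exact: compS (recS_const 1 0).
- by apply/compS/recS_digits => //; apply/recS_succ/recS_succ/recS_nth.
- by apply: compS; apply: recS_exp; [exact: recS_const | exact: recS_nth].
- by move=> d; apply/eqP; rewrite -lt0n expn_gt0.
move=> d; rewrite expr0 mul1r natrX.
have scale x : 4 * x / 2 ^+ d.+2 = x / 2 ^+ d :> R.
  by rewrite !exprS; field; rewrite expf_neq0.
have /andP[] := thetaP d.+2; rewrite !scale -[(a _).+1%:R]natr1 mulrDl mul1r => x1 x2.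
by rewrite ler_norml; lra.
Qed.
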